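(* Let $E$ be a non-trivial locally convex Hausdorff space over $\mathbb{K}$, let $(T^{E}_{m},T^{\mathbb{K}}_{m})_{m\in M}$ be a strong and consistent generator for $(\mathcal{FV},E)$ and suppose $\mathcal{FV}(\Omega,E)\subset\mathcal{FV}(\Omega,E)_\kappa$. Assume one of the following holds: (a) $E$ is complete; (b) $E$ is quasi-complete and for every $f\in\mathcal{FV}(\Omega,E)$ and $f'\in\mathcal{FV}(\Omega)'$ there is a bounded net $(f'_\tau)_{\tau\in\mathcal{T}}$ in $\mathcal{FV}(\Omega)'$ converging to $f'$ in $\mathcal{FV}(\Omega)'_\kappa$ with $R_f^t(f'_\tau)\in\mathcal{J}(E)$ for every $\tau$; (c) $E$ is sequentially complete and for every $f\in\mathcal{FV}(\Omega,E)$ and $f'\in\mathcal{FV}(\Omega)'$ there is a sequence $(f'_n)_{n\in\mathbb{N}}$ in $\mathcal{FV}(\Omega)'$ converging to $f'$ in $\mathcal{FV}(\Omega)'_\kappa$ with $R_f^t(f'_n)\in\mathcal{J}(E)$ for every $n$; (d) for every $f\in\mathcal{FV}(\Omega,E)$, $j\in J$, $m\in M$ there is an absolutely convex, $\sigma(E,E')$-compact set $K\subset E$ with $N_{j,m}(f)\subset K$. Then $S\colon\mathcal{FV}(\Omega)\varepsilon E\to\mathcal{FV}(\Omega,E)$ is a topological isomorphism (onto), and its inverse is $f\mapsto\mathcal{J}^{-1}\circ R_f^t$.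
   Context: $\mathbb{K}\in\{\mathbb{R},\mathbb{C}\}$. Let $\Omega$ be a non-empty set, $J,M$ non-empty index sets, $(\omega_m)_{m\in M}$ non-empty sets and $\nu_{j,m}\colon\omega_m\to[0,\infty)$ ($j\in J,m\in M$) such that for all $m$, $x\in\omega_m$ some $\nu_{j,m}(x)>0$. For $Y\in\{\mathbb{K},E\}$, $E$ having directed fundamental system of seminorms $(p_\alpha)_{\alpha\in\mathfrak{A}}$ (for $\mathbb{K}$ only $|\cdot|$), let $\operatorname{AP}(\Omega,Y)\subset Y^\Omega$ be a linear subspace and $T^Y_m\colon\operatorname{dom}T^Y_m\to Y^{\omega_m}$ linear maps on linear subspaces $\operatorname{dom}T^Y_m\subset Y^\Omega$. $\mathcal{FV}(\Omega,Y):=\{f\in\operatorname{AP}(\Omega,Y)\cap\bigcap_m\operatorname{dom}T^Y_m: |f|_{j,m,\alpha}:=\sup_{x\in\omega_m}p_\alpha(T^Y_m(f)(x))\nu_{j,m}(x)<\infty\ \forall j,m,\alpha\}$ with these seminorms; $\mathcal{FV}(\Omega):=\mathcal{FV}(\Omega,\mathbb{K})$, $|f|_{j,m}$ its seminorms, $T^Y_{m,x}(f):=T^Y_m(f)(x)$. Dom-space: Hausdorff, directed seminorms, and for $Y=\mathbb{K}$ all $\delta_x\colon f\mapsto f(x)$ are in $\mathcal{FV}(\Omega)'$. Generator for $(\mathcal{FV},E)$: $(T^E_m,T^{\mathbb{K}}_m)_{m\in M}$ with $\mathcal{FV}(\Omega)$, $\mathcal{FV}(\Omega,E)$ dom-spaces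 over the same $J,M,\omega_m,\nu_{j,m}$. $\mathcal{FV}(\Omega)\varepsilon E$: continuous linear maps $\mathcal{FV}(\Omega)'_\kappa\to E$ ($\kappa$: uniform convergence on absolutely convex compact sets) with topology of uniform convergence on equicontinuous subsets of $\mathcal{FV}(\Omega)'$; $S(u)(x):=u(\delta_x)$. Consistent: for all $u\in\mathcal{FV}(\Omega)\varepsilon E$, $m$, $x\in\omega_m$: $S(u)\in\operatorname{AP}(\Omega,E)\cap\operatorname{dom}T^E_m$ and $T^E_m(S(u))(x)=u(T^{\mathbb{K}}_{m,x})$. Strong: for all $e'\in E'$, $f\in\mathcal{FV}(\Omega,E)$, $m$: $e'\circ f\in\operatorname{AP}(\Omega,\mathbb{K})\cap\operatorname{dom}T^{\mathbb{K}}_m$ and $T^{\mathbb{K}}_m(e'\circ f)=e'\circ T^E_m(f)$ on $\omega_m$. $\mathcal{FV}(\Omega,E)_\sigma:=\{f\colon\Omega\to E: e'\circ f\in\mathcal{FV}(\Omega)\ \forall e'\in E'\}$; for such $f$, $R_f\colon E'\to\mathcal{FV}(\Omega)$, $R_f(e'):=e'\circ f$, and $R_f^t\colon\mathcal{FV}(\Omega)'\to E'^{\star}$ (algebraic dual of $E'$), $R_f^t(f')(e'):=f'(R_f(e'))$. $B_\alpha:=\{x\in E: p_\alpha(x)<1\}$, $B_\alpha^\circ$ its polar; $\mathcal{FV}(\Omega,E)_\kappa:=\{f\in\mathcal{FV}(\Omega,E)_\sigma: R_f(B_\alpha^\circ)$ relatively compact in $\mathcal{FV}(\Omega)$ for all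 $\alpha\}$. $\mathcal{J}\colon E\to E'^{\star}$ the canonical injection. $N_{j,m}(f):=\{T^E_m(f)(x)\nu_{j,m}(x): x\in\omega_m\}$. *)

(* Defs.v *)
From HB Require Import structures.
From mathcomp Require Import all_boot all_algebra.
From mathcomp Require Import all_classical all_reals.
From mathcomp Require Import complex.
Set Implicit Arguments.
Unset Strict Implicit.
Unset Printing Implicit Defensive.
Import GRing.Theory Num.Theory.
Fixpoint seqIn (T : Type) (x : T) (s : seq T) : Prop :=
  match s with nil => False | y :: s' => y = x \/ seqIn x s' end.
Local Open Scope classical_set_scope.
Local Open Scope ring_scope.

Definition Kf (R : realType) (b : bool) : numFieldType :=
  if b then (R : numFieldType) else (R[i] : numFieldType).

Definition nK (R : realType) (b : bool) : Kf R b -> R :=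
  match b as b' return Kf R b' -> R with
  | true => fun x : R => `|x|
  | false => fun z : R[i] => Normc.normc z
  end.

Definition RK (R : realType) (b : bool) : R -> Kf R b :=
  match b as b' return R -> Kf R b' with
  | true => fun x : R => x
  | false => fun r : R => (Complex r 0 : R[i])
  end.

(* Generic topology of a subset D of a Z-module V, induced by a family of
   (real valued) seminorms q : I -> V -> R.  The basic neighbourhoods of x
   are the finite intersections of seminorm balls.                      *)
Section SeminormTopology.
Variables (R : realType) (V : zmodType) (I : Type) (q : I -> V -> R) (D : set V).

Definition sball (F : seq I) (x : V) (e : R) : set V :=
  [set y | forall i, seqIn i F -> q i (y - x) < e].

Definition sopen (U : set V) : Prop :=
  U `<=` D /\
  forall x, U x -> exists (F : seq I) (e : R), 0 < e /\ D `&` sball F x e `<=` U.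

Definition sclosure (A : set V) : set V :=
  [set x | D x /\ forall (F : seq I) (e : R), 0 < e -> exists y, A y /\ sball F x e y].

Definition sclosed (A : set V) : Prop := A `<=` D /\ sclosure A `<=` A.

Definition scompact (A : set V) : Prop :=
  A `<=` D /\
  forall C : set (set V), (forall U, C U -> sopen U) ->
    A `<=` \bigcup_(U in C) U ->
    exists s : seq (set V), (forall U, seqIn U s -> C U) /\
      A `<=` \bigcup_(U in [set U | seqIn U s]) U.

Definition srelcompact (A : set V) : Prop := scompact (sclosure A).

Definition shausdorff : Prop :=
  forall x y, D x -> D y -> x <> y ->
    exists U W, sopen U /\ sopen W /\ U x /\ W y /\ U `&` W = set0.

Definition sdirected : Prop :=
  forall i1 i2 : I, exists (i3 : I) (C : R), 0 < C /\
    forall x, D x -> Num.max (q i1 x) (q i2 x) <= C * q i3 x.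

Definition net_cvg (T : Type) (le : T -> T -> Prop) (x : T -> V) (l : V) : Prop :=
  forall (F : seq I) (e : R), 0 < e -> exists t0, forall t, le t0 t -> sball F l e (x t).

Definition net_cauchy (T : Type) (le : T -> T -> Prop) (x : T -> V) : Prop :=
  forall (F : seq I) (e : R), 0 < e -> exists t0, forall s t, le t0 s -> le t0 t ->
    forall i, seqIn i F -> q i (x s - x t) < e.

Definition sbounded (K : Type) (scale : K -> V -> V) (A : set V) : Prop :=
  forall U, sopen U -> U 0 -> exists l : K, forall x, A x -> exists y, U y /\ x = scale l y.

End SeminormTopology.

Definition directed_order (T : Type) (le : T -> T -> Prop) : Prop :=
  (exists t : T, True) /\ (forall t, le t t) /\
  (forall s t u, le s t -> le t u -> le s u) /\
  (forall s t, exists u, le s u /\ le t u).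

Definition scont (R : realType) (V1 V2 : zmodType) (I1 I2 : Type)
  (q1 : I1 -> V1 -> R) (D1 : set V1) (q2 : I2 -> V2 -> R) (D2 : set V2)
  (f : V1 -> V2) : Prop :=
  (forall x, D1 x -> D2 (f x)) /\
  forall U, sopen q2 D2 U -> sopen q1 D1 (D1 `&` f @^-1` U).

Definition scomplete (R : realType) (V : zmodType) (I : Type) (q : I -> V -> R) (D : set V) :=
  forall (T : Type) (le : T -> T -> Prop), directed_order le ->
    forall x : T -> V, (forall t, D (x t)) -> net_cauchy q le x ->
      exists l, D l /\ net_cvg q le x l.

Definition squasi_complete (R : realType) (V : zmodType) (I : Type) (q : I -> V -> R)
    (D : set V) (K : Type) (scale : K -> V -> V) :=
  forall A : set V, sbounded q D scale A -> sclosed q D A ->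
  forall (T : Type) (le : T -> T -> Prop), directed_order le ->
    forall x : T -> V, (forall t, A (x t)) -> net_cauchy q le x ->
      exists l, A l /\ net_cvg q le x l.

Definition sseq_complete (R : realType) (V : zmodType) (I : Type) (q : I -> V -> R) (D : set V) :=
  forall x : nat -> V, (forall n, D (x n)) -> net_cauchy q (fun m n => (m <= n)%N) x ->
    exists l, D l /\ net_cvg q (fun m n => (m <= n)%N) x l.

Section FVsetting.
Variables (R : realType) (b : bool).
Local Notation K := (Kf R b).
Local Notation nK := (@nK R b).

Definition qK : unit -> K -> R := fun _ z => nK z.

Section E.
Variables (E : lmodType K) (A : Type) (p : A -> E -> R).

Definition is_seminorm (s : E -> R) : Prop :=
  (forall x, 0 <= s x) /\ (forall x y, s (x + y) <= s x + s y) /\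
  (forall (l : K) x, s (l *: x) = nK l * s x).

Definition lsubE (Om : Type) (S : set (Om -> E)) : Prop :=
  S (fun _ => 0) /\ forall (l : K) f g, S f -> S g -> S (fun w => l *: f w + g w).

Definition Edual : set (E -> K) :=
  [set e' | (forall (l : K) x y, e' (l *: x + y) = l * e' x + e' y) /\
            scont p setT qK setT e'].

Definition qweak : {e' : E -> K | Edual e'} -> E -> R := fun e' x => nK (sval e' x).

Definition absconvexE (C : set E) : Prop :=
  forall x y, C x -> C y -> forall l m : K, nK l + nK m <= 1 -> C (l *: x + m *: y).

Definition polarB (a : A) : set (E -> K) :=
  [set e' | Edual e' /\ forall x, p a x < 1 -> nK (e' x) <= 1].

End E.

Definition lsubK (Om : Type) (S : set (Om -> K)) : Prop :=
  S (fun _ => 0) /\ forall (l : K) f g, S f -> S g -> S (fun w => l * f w + g w).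

Section FV.
Variables (Om : Type) (J M : Type) (om : M -> Type) (nu : J -> forall m, om m -> R).
Variables (APK : set (Om -> K)) (domTK : forall m : M, set (Om -> K))
          (TK : forall m : M, (Om -> K) -> (om m -> K)).
Variables (E : lmodType K) (A : Type) (p : A -> E -> R).
Variables (APE : set (Om -> E)) (domTE : forall m : M, set (Om -> E))
          (TE : forall m : M, (Om -> E) -> (om m -> E)).
Arguments TK : clear implicits.
Arguments TE : clear implicits.
Arguments nu : clear implicits.

Definition FVK : set (Om -> K) :=
  [set f | APK f /\ forall m, domTK m f /\
     forall j, exists C : R, forall x : om m, nK (TK m f x) * nu j m x <= C].

Definition semFVK (jm : J * M) (f : Om -> K) : R :=
  sup (range (fun x : om jm.2 => nK (TK jm.2 f x) * nu jm.1 jm.2 x)).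

Definition FVE : set (Om -> E) :=
  [set f | APE f /\ forall m, domTE m f /\
     forall j a, exists C : R, forall x : om m, p a (TE m f x) * nu j m x <= C].

Definition semFVE (jma : J * M * A) (f : Om -> E) : R :=
  sup (range (fun x : om jma.1.2 =>
    p jma.2 (TE jma.1.2 f x) * nu jma.1.1 jma.1.2 x)).

Definition FVdual : set ((Om -> K) -> K) :=
  [set f' | (forall (l : K) f g, FVK f -> FVK g ->
               f' (fun w => l * f w + g w) = l * f' f + f' g) /\
            scont semFVK FVK qK setT f'].

Definition delta (x : Om) : (Om -> K) -> K := fun f => f x.

Definition dom_space_K : Prop :=
  shausdorff semFVK FVK /\ sdirected semFVK FVK /\ forall x, FVdual (delta x).

Definition dom_space_E : Prop :=
  shausdorff semFVE FVE /\ sdirected semFVE FVE.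

(* the topology kappa on FV(Om)': uniform convergence on absolutely
   convex compact subsets of FV(Om) *)
Definition absconvexK (B : set (Om -> K)) : Prop :=
  forall f g, B f -> B g -> forall l m : K, nK l + nK m <= 1 ->
    B (fun w => l * f w + m * g w).

Definition kappa_idx := {B : set (Om -> K) | absconvexK B /\ scompact semFVK FVK B}.

Definition semKappa (B : kappa_idx) (f' : (Om -> K) -> K) : R :=
  sup ((fun f => nK (f' f)) @` sval B).

Definition scaleDual (l : K) (f' : (Om -> K) -> K) : (Om -> K) -> K :=
  fun f => l * f' f.

Definition equicont (H : set ((Om -> K) -> K)) : Prop :=
  H `<=` FVdual /\
  forall f0, FVK f0 -> forall e : R, 0 < e -> exists U, sopen semFVK FVK U /\ U f0 /\
    forall f' f, H f' -> U f -> nK (f' f - f' f0) < e.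

(* FV(Om) eps E = L(FV(Om)'_kappa, E) with the topology of uniform
   convergence on equicontinuous subsets of FV(Om)' *)
Definition epsprod : set (((Om -> K) -> K) -> E) :=
  [set u | (forall (l : K) f' g', FVdual f' -> FVdual g' ->
              u (fun f => l * f' f + g' f) = l *: u f' + u g') /\
           scont semKappa FVdual p setT u].

Definition eps_idx := ({H : set ((Om -> K) -> K) | equicont H} * A)%type.

Definition semEps (i : eps_idx) (u : ((Om -> K) -> K) -> E) : R :=
  sup ((fun f' => p i.2 (u f')) @` sval i.1).

Definition S (u : ((Om -> K) -> K) -> E) : Om -> E := fun x => u (delta x).

Definition consistent : Prop :=
  forall u, epsprod u -> forall m, APE (S u) /\ domTE m (S u) /\
    forall x : om m, TE m (S u) x = u (fun f => TK m f x).

Definition strong : Prop :=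
  forall e', Edual p e' -> forall f, FVE f -> forall m,
    APK (fun w => e' (f w)) /\ domTK m (fun w => e' (f w)) /\
    forall x : om m, TK m (fun w => e' (f w)) x = e' (TE m f x).

Definition FVsigma : set (Om -> E) := [set f | forall e', Edual p e' -> FVK (fun w => e' (f w))].

Definition Rf (f : Om -> E) (e' : E -> K) : Om -> K := fun w => e' (f w).

Definition Rft (f : Om -> E) (f' : (Om -> K) -> K) : (E -> K) -> K := fun e' => f' (Rf f e').

Definition JE (x : E) : (E -> K) -> K := fun e' => e' x.

(* R_f^t(f') \in J(E), as elements of the algebraic dual of E' *)
Definition in_JE (f : Om -> E) (f' : (Om -> K) -> K) : Prop :=
  exists x : E, forall e', Edual p e' -> Rft f f' e' = JE x e'.

Definition FVkappa : set (Om -> E) :=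
  [set f | FVsigma f /\ forall a, srelcompact semFVK FVK (Rf f @` polarB p a)].

Definition Nset (f : Om -> E) (j : J) (m : M) : set E :=
  range (fun x : om m => RK b (nu j m x) *: TE m f x).

End FV.
End FVsetting.

(* Main.v *)
Require Import Defs.
From HB Require Import structures.
From mathcomp Require Import all_boot all_order all_algebra.
From mathcomp Require Import all_classical all_reals.
From mathcomp Require Import complex ring lra.
Import Order.TTheory GRing.Theory Num.Theory.
Local Open Scope classical_set_scope.
Local Open Scope ring_scope.

(** For [f] in FV(Om,E) everything reduces to showing that the functional
    [e' |-> f' (e' o f)] on E' is evaluation at a point [u f'] of E: then
    Hahn-Banach gives [p_a (u f') = sup |f' (e' o f)|] over the polar of [B_a],
    which is a kappa-seminorm of [f'] because [R_f] maps that polar to a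
    relatively compact set.
    Absolutely convex absorbing sets are separated from points, applied in
    finite dimension.  On a compact set the FV-topology is the pointwise one,
    so [f'] is a uniform limit there of linear combinations of point
    evaluations; these combinations are kappa-dense, which gives injectivity
    of S, and they correspond to points of E, which gives (a).  In (b) and (c)
    the given net plays their role.  In (d), finitely many values of the
    functional are approximated from a multiple of the weakly compact set, and
    compactness yields the point. *)

(** Openness of [S] rests on a formula for arbitrary [u]: [p a (u f')] is the supremum of
    [nK (f' (Rf (S u) e'))] over the polar, and for [f'] in an equicontinuous set this is controlled
    by finitely many seminorms of [S u]. The formula itself is read off from surjectivity and
    injectivity together, hence the order of the argument. Finite-dimensional separation suffices
    because compactness leaves finitely many functionals and a uniform gap [d]; thickening the image
    of the compact set by this gap makes it absorbing. Two features of the encoding shape the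
    estimates. The spaces are subsets [D] of full function spaces, so a seminorm or a functional is
    meaningful on [D] alone. And [sup] is 0 on sets that are empty or unbounded, so boundedness has
    to be proved before a supremum can be used, and upper bounds carry the side condition [0 <= c]
    where the set may be empty. *)

Section Scalars.
Context {R : realType} {b : bool}.
Local Notation K := (Kf R b).
Local Notation nK := (@nK R b).
Local Notation RK := (@RK R b).

Lemma nK_ge0 (x : K) : 0 <= nK x.
Proof. by case: b x => /= [x|[x y]]; [exact: normr_ge0|exact: sqrtr_ge0]. Qed.

Lemma nK_triangle (x y : K) : nK (x + y) <= nK x + nK y.
Proof. by case: b x y => /= x y; [exact: ler_normD|exact: le_normcD]. Qed.

Lemma nKM (x y : K) : nK (x * y) = nK x * nK y.
Proof. by case: b x y => /= x y; [exact: normrM|exact: Normc.normcM]. Qed.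

Lemma nK_eq0 (x : K) : nK x = 0 -> x = 0.
Proof. by case: b x => /= x; [exact: normr0_eq0|exact: Normc.eq0_normc]. Qed.

Lemma nK0 : nK 0 = 0.
Proof. by case: b => /=; [exact: normr0|exact: Normc.normc0]. Qed.

Lemma nKN (x : K) : nK (- x) = nK x.
Proof. by case: b x => /= x; [exact: normrN|exact: normcN]. Qed.

Lemma nKB (x y : K) : nK (x - y) = nK (y - x).
Proof. by rewrite -nKN opprB. Qed.

Lemma nK1 : nK 1 = 1.
Proof. by case: b => /=; [exact: normr1|exact: Normc.normc1]. Qed.

Lemma nK_gt0 (x : K) : x <> 0 -> 0 < nK x.
Proof.
move=> x0; rewrite lt_neqAle nK_ge0 andbT eq_sym.
by apply/eqP => /nK_eq0.
Qed.

Lemma nKV (x : K) : nK x^-1 = (nK x)^-1.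
Proof.
have [->|x0] := eqVneq x 0; first by rewrite invr0 nK0 invr0.
have nx0 : nK x != 0 by apply/eqP => /nK_eq0 /eqP; rewrite (negbTE x0).
by apply: (mulfI nx0); rewrite -nKM !divff// nK1.
Qed.

Lemma nKRK (r : R) : nK (RK r) = `|r|.
Proof. by case: b => //=; rewrite expr0n /= addr0 sqrtr_sqr. Qed.

Lemma nKRK_ge0 {r : R} : 0 <= r -> nK (RK r) = r.
Proof. by move=> r0; rewrite nKRK ger0_norm. Qed.

Lemma RK1 : RK 1 = 1.
Proof. by case: b. Qed.

Lemma RK0 : RK 0 = 0.
Proof. by case: b. Qed.

Lemma RKD (r s : R) : RK (r + s) = RK r + RK s.
Proof. by case: b => //=; apply/eqP; rewrite eq_complex /= addr0 !eqxx. Qed.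

Lemma RKM (r s : R) : RK (r * s) = RK r * RK s.
Proof.
by case: b => //=; apply/eqP; rewrite eq_complex /= !(mulr0, mul0r, subr0, addr0) !eqxx.
Qed.

Lemma RKN (r : R) : RK (- r) = - RK r.
Proof. by apply/eqP; rewrite -addr_eq0 -RKD addNr RK0. Qed.

Lemma RK_neq0 (r : R) : r != 0 -> RK r != 0.
Proof.
apply: contra => /eqP h; rewrite -normr_eq0 -nKRK h.
by apply/eqP; exact: nK0.
Qed.

Lemma RKV (r : R) : RK r^-1 = (RK r)^-1.
Proof.
have [->|r0] := eqVneq r 0; first by rewrite invr0 RK0 invr0.
by apply: (mulfI (RK_neq0 _ r0)); rewrite -RKM !divff ?RK1 ?RK_neq0.
Qed.

End Scalars.

(** * Separation of a point from an absolutely convex absorbing set *)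

Section HahnBanach.
Context {R : realType} {b : bool} {V : lmodType (Kf R b)}.
Local Notation K := (Kf R b).
Local Notation nK := (@nK R b).
Local Notation RK := (@RK R b).

Definition sublinear (q : V -> R) : Prop :=
  (forall x y, q (x + y) <= q x + q y) /\
  (forall r x, 0 < r -> q (RK r *: x) <= r * q x).

Lemma sublinear0 (q : V -> R) : sublinear q -> q 0 = 0.
Proof.
move=> [_ qh]; have := qh 2 0; have := qh 2^-1 0.
rewrite !scaler0 invr_gt0 ltr0n => /(_ isT) h1 /(_ isT) h2; lra.
Qed.

Lemma sublinearZ (q : V -> R) r x : sublinear q -> 0 <= r -> q (RK r *: x) = r * q x.
Proof.
move=> ql; rewrite le_eqVlt => /predU1P[<-|r0].
  by rewrite RK0 scale0r mul0r sublinear0.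
apply/eqP; rewrite eq_le ql.2//=.
have := ql.2 r^-1 (RK r *: x); rewrite invr_gt0 => /(_ r0).
rewrite scalerA -RKM mulVf ?gt_eqF// RK1 scale1r => h.
by rewrite -ler_pdivlMl.
Qed.

Lemma sublinear_ge (q : V -> R) x : sublinear q -> - q (- x) <= q x.
Proof.
move=> ql; have := ql.1 x (- x); rewrite subrr sublinear0// => h; lra.
Qed.

(** For sublinear [q], the largest sublinear minorant of [q] whose value at [- y] is at most
    [- q y]; a linear functional below it is at least [q y] at [y]. *)
Definition tilt (q : V -> R) (y x : V) : R :=
  inf [set q (x + RK t *: y) - t * q y | t in [set t | 0 <= t]].

Lemma tilt_le (q : V -> R) y x t :
  sublinear q -> 0 <= t -> tilt q y x <= q (x + RK t *: y) - t * q y.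
Proof.
move=> ql t0; apply: ge_inf; last by exists t.
(* A lower bound makes the infimum genuine: [s * q y = q (RK s *: y)] is at most
   [q (x + RK s *: y) + q (- x)]. *)
exists (- q (- x)) => _ [s /= s0 <-].
rewrite -(sublinearZ _ _ _ ql s0).
have := ql.1 (x + RK s *: y) (- x).
by rewrite [x + _]addrC addrK => h; lra.
Qed.

Lemma le_tilt (q : V -> R) y x c :
  (forall t, 0 <= t -> c <= q (x + RK t *: y) - t * q y) -> c <= tilt q y x.
Proof.
move=> h; apply: lb_le_inf; last by move=> _ [t /= t0 <-]; exact: h.
by exists (q (x + RK 0 *: y) - 0 * q y); exists 0 => /=.
Qed.

Lemma sublinear_tilt (q : V -> R) y : sublinear q -> sublinear (tilt q y).
Proof.
move=> ql; split=> [x x'|r x r0].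
  rewrite -lerBlDr; apply: le_tilt => t t0; rewrite lerBlDl -lerBlDr.
  apply: le_tilt => t' t'0; rewrite lerBlDr.
  have := tilt_le q y (x + x') (t + t') ql (addr_ge0 t0 t'0).
  have := ql.1 (x + RK t *: y) (x' + RK t' *: y).
  by rewrite RKD scalerDl addrACA => h1 h2; lra.
rewrite -ler_pdivrMl//; apply: le_tilt => t t0; rewrite ler_pdivrMl//.
have := tilt_le q y (RK r *: x) (r * t) ql (mulr_ge0 (ltW r0) t0).
have := ql.2 r (x + RK t *: y) r0.
by rewrite RKM scalerDr scalerA => h1 h2; lra.
Qed.

Lemma tilt_le_id (q : V -> R) y x : sublinear q -> tilt q y x <= q x.
Proof.
move=> ql; have := tilt_le q y x 0 ql (lexx _).
by rewrite RK0 scale0r addr0 mul0r subr0.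
Qed.

(** Zorn's lemma for the reversed pointwise order. The members of a chain are bounded below by
    [- q (- x)], and the pointwise infimum stays subadditive because the smaller of two members
    serves for both summands. *)
Lemma exists_minimal_sublinear (q : V -> R) : sublinear q ->
  exists g, [/\ sublinear g, (forall x, g x <= q x) &
    forall h, sublinear h -> (forall x, h x <= g x) -> forall x, g x <= h x].
Proof.
move=> ql.
pose T := {g : V -> R | sublinear g /\ forall x, g x <= q x}.
pose t0 : T := exist _ q (conj ql (fun x => lexx (q x))).
pose le (s t : T) := `[< forall x, sval t x <= sval s x >].
have [| | |g gmin] := @ZL_preorder T t0 le.
- by move=> t; apply/asboolP.
- move=> r s t /asboolP rs /asboolP st; apply/asboolP => x.
  exact: le_trans (st x) (rs x).
- move=> C Ctot; have [[s0 Cs0]|C0] := pselect (exists s, C s); last first.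
    by exists t0 => s Cs; case: C0; exists s.
  pose h x := inf [set sval s x | s in C].
  have h_le s x : C s -> h x <= sval s x.
    move=> Cs; apply: ge_inf; last by exists s.
    exists (- q (- x)) => _ [t _ <-].
    have [tl tq] := svalP t; have := sublinear_ge _ x tl; have := tq (- x).
    by lra.
  have le_h x c : (forall s, C s -> c <= sval s x) -> c <= h x.
    move=> H; apply: lb_le_inf; first by exists (sval s0 x), s0.
    by move=> _ [s Cs <-]; exact: H.
  have hl : sublinear h.
    split=> [x y|r x r0].
      rewrite -lerBlDr; apply: (le_h) => s Cs; rewrite lerBlDl -lerBlDr.
      apply: (le_h) => t Ct; rewrite lerBlDr.
      case: (Ctot s t Cs Ct) => /asboolP H.
        have := h_le t (x + y) Ct; have := (svalP t).1.1 x y.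
        by have := H x; lra.
      have := h_le s (x + y) Cs; have := (svalP s).1.1 x y.
      by have := H y; lra.
    rewrite -ler_pdivrMl//; apply: (le_h) => s Cs; rewrite ler_pdivrMl//.
    exact: le_trans (h_le s _ Cs) ((svalP s).1.2 _ _ r0).
  have hq x : h x <= q x by exact: le_trans (h_le s0 x Cs0) ((svalP s0).2 x).
  exists (exist _ h (conj hl hq)) => s Cs; apply/asboolP => x /=; exact: h_le.
exists (sval g); have [gl gq] := svalP g; split=> // h hl hg.
have hq x : h x <= q x by exact: le_trans (hg x) (gq x).
have /asboolP := gmin (exist _ h (conj hl hq)) (introT (asboolP _) hg).
by [].
Qed.

(* A minimal sublinear functional equals each of its tilts, which forces
   additivity. *)
Lemma hahn_banach_real (q : V -> R) (v : V) : sublinear q ->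
  exists g : V -> R, [/\ (forall x y, g (x + y) = g x + g y),
    (forall r x, g (RK r *: x) = r * g x), (forall x, g x <= q x) & q v <= g v].
Proof.
(* Minimality is taken below [tilt q v] rather than [q]: this forces [g (- v) <= - q v], which is
   the last inequality. *)
move=> ql; have [g [gl gq gmin]] := exists_minimal_sublinear _ (sublinear_tilt _ v ql).
have gadd x y : g (x + y) = g x + g y.
  apply/eqP; rewrite eq_le gl.1/=.
  have := gmin _ (sublinear_tilt _ y gl) (fun z => tilt_le_id _ y z gl) x.
  have := tilt_le g y x 1 gl ler01; rewrite RK1 scale1r mul1r; lra.
have gN x : g (- x) = - g x.
  by have := gadd x (- x); rewrite subrr sublinear0// => h; lra.
exists g; split=> //.
- move=> r x; have [r0|r0] := leP 0 r; first exact: sublinearZ.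
  rewrite -[r]opprK RKN scaleNr gN sublinearZ ?mulNr// oppr_ge0; exact: ltW.
- by move=> x; exact: le_trans (gq x) (tilt_le_id _ v x ql).
- have := gq (- v); have := tilt_le q v (- v) 1 ql ler01.
  by rewrite gN RK1 scale1r addNr mul1r sublinear0//; lra.
Qed.

End HahnBanach.

(** In the complex case the functional is recovered from its real part as [g x - i g (i x)];
    multiplying [x] by a unimodular scalar that makes this value real turns the bound on [g] into
    one on the modulus. *)
Lemma complexify (R : realType) (b : bool) (V : lmodType (Kf R b)) (q g : V -> R) (v : V) :
  (forall x y, g (x + y) = g x + g y) -> (forall r x, g (RK b r *: x) = r * g x) ->
  (forall x, g x <= q x) -> (forall l x, q (l *: x) <= nK l * q x) ->
  exists G : V -> Kf R b, [/\ (forall l x y, G (l *: x + y) = l * G x + G y),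
    (forall x, nK (G x) <= q x) & g v <= nK (G v)].
Proof.
case: b V q g v => /= V q g v gD gZ gq qZ.
  exists g; split=> [l x y|x|]; last exact: ler_norm.
    by rewrite gD gZ.
  rewrite ler_norml gq andbT.
  have := gq (RK true (-1) *: x); rewrite gZ.
  have := qZ (-1) x; rewrite /= normrN1 /RK /=; lra.
pose G x : R[i] := Complex (g x) (- g (('i%C : R[i]) *: x)).
have GD x y : G (x + y) = G x + G y.
  by rewrite /G scalerDr !gD opprD.
have Gr r x : G (Complex r 0 *: x) = Complex r 0 * G x.
  rewrite /G scalerA mulrC -scalerA !gZ; apply/eqP.
  by rewrite eq_complex /= !mul0r subr0 addr0 mulrN !eqxx.
have Gi x : G (('i%C : R[i]) *: x) = 'i%C * G x.
  have -> : G (('i%C : R[i]) *: x) = Complex (g (('i%C : R[i]) *: x)) (g x).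
    rewrite /G scalerA -expr2 sqr_i; congr Complex.
    have := gZ (-1) x; rewrite /=.
    have -> : Complex (-1 : R) 0 = -1 by apply/eqP; rewrite eq_complex /= oppr0 !eqxx.
    by move=> ->; rewrite mulN1r opprK.
  by apply/eqP; rewrite eq_complex /= !(mul0r, mul1r, sub0r, add0r) opprK !eqxx.
have GZ l x : G (l *: x) = l * G x.
  have {1 2}-> : l = Complex (complex.Re l) 0 + 'i%C * Complex (complex.Im l) 0.
    by case: l => r s; apply/eqP; rewrite eq_complex /=;
       rewrite !(mul0r, mul1r, mulr0, mulr1, subr0, addr0, add0r) !eqxx.
  by rewrite scalerDl GD Gr -scalerA Gi Gr mulrDl mulrA.
exists G; split=> [l x y|x|]; first by rewrite GD GZ.
- have q0 : 0 <= q x.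
    have := gq x; have := gq (Complex (-1 : R) 0 *: x); rewrite gZ.
    have := qZ (Complex (-1 : R) 0) x; rewrite /= expr0n/= addr0 sqrtr_sqr normrN1; lra.
  have [Gx0|Gx0] := eqVneq (G x) 0; first by rewrite Gx0 Normc.normc0.
  pose n := Normc.normc (G x).
  have n0 : n != 0 by apply/eqP => /Normc.eq0_normc /eqP; rewrite (negbTE Gx0).
  pose l := Complex n 0 / G x.
  have nl : Normc.normc l = 1.
    rewrite /l Normc.normcM Normc.normcV /= expr0n /= addr0 sqrtr_sqr.
    by rewrite -/n ger0_norm ?divff//; apply: sqrtr_ge0.
  have gl : g (l *: x) = n.
    have := GZ l x; rewrite /l mulfVK// => h.
    by have := congr1 (@complex.Re R) h.
  by rewrite -[leLHS]/n -gl; apply: le_trans (gq _) _; rewrite -[leRHS]mul1r -nl; exact: qZ.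
- rewrite /= (le_trans (ler_norm _))// -sqrtr_sqr ler_sqrt.
    by rewrite lerDl sqr_ge0.
  by rewrite addr_ge0 ?sqr_ge0.
Qed.

Section Separation.
Context {R : realType} {b : bool} {V : lmodType (Kf R b)}.
Local Notation K := (Kf R b).
Local Notation nK := (@nK R b).
Local Notation RK := (@RK R b).
Variable D : set V.
Hypothesis D_absconvex : absconvexE D.
Hypothesis D_absorbing : forall x, exists2 r : R, 0 < r & D (RK r *: x).

Definition gauge (x : V) : R := inf [set r | 0 < r /\ D (RK r^-1 *: x)].

Lemma gauge_le x r : 0 < r -> D (RK r^-1 *: x) -> gauge x <= r.
Proof. by move=> r0 Dx; apply: ge_inf => //; exists 0 => s [/ltW]. Qed.

Lemma le_gauge x c : (forall r, 0 < r -> D (RK r^-1 *: x) -> c <= r) -> c <= gauge x.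
Proof.
move=> h; apply: lb_le_inf; last by move=> r [r0 Dx]; exact: h.
by have [r r0 Dx] := D_absorbing x; exists r^-1; rewrite /= invrK invr_gt0.
Qed.

Lemma absconvex_balanced l x : D x -> nK l <= 1 -> D (l *: x).
Proof.
move=> Dx l1; rewrite -[l *: x]addr0 -(scale0r x).
by apply: D_absconvex => //; rewrite nK0 addr0.
Qed.

Lemma gaugeD x y : gauge (x + y) <= gauge x + gauge y.
Proof.
rewrite -lerBlDr; apply: le_gauge => r r0 Dx; rewrite lerBlDl -lerBlDr.
apply: le_gauge => s s0 Dy; rewrite lerBlDr.
have rs0 : 0 < s + r by rewrite addr_gt0.
apply: gauge_le => //.
have -> : RK (s + r)^-1 *: (x + y) =
    RK (r / (s + r)) *: (RK r^-1 *: x) + RK (s / (s + r)) *: (RK s^-1 *: y).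
  rewrite !scalerA -!RKM [r / _]mulrC [s / _]mulrC !mulfK ?gt_eqF//.
  by rewrite scalerDr.
apply: D_absconvex => //; rewrite !nKRK_ge0; last 2 first.
- by rewrite divr_ge0 ?ltW.
- by rewrite divr_ge0 ?ltW.
by rewrite -mulrDl [r + s]addrC divff ?gt_eqF.
Qed.

Lemma gaugeZ l x : gauge (l *: x) <= nK l * gauge x.
Proof.
have [->|/eqP/nK_gt0 l0] := eqVneq l 0.
  rewrite scale0r nK0 mul0r; apply/ler_addgt0Pr => e e0; rewrite add0r.
  apply: gauge_le => //; have [r r0 Dr] := D_absorbing 0.
  by rewrite scaler0; rewrite scaler0 in Dr.
rewrite -ler_pdivrMl//; apply: le_gauge => r r0 Dx; rewrite ler_pdivrMl//.
apply: gauge_le; first by rewrite mulr_gt0.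
have -> : RK (nK l * r)^-1 *: (l *: x) = (l / RK (nK l)) *: (RK r^-1 *: x).
  by rewrite !scalerA invfM RKM !RKV; congr (_ *: _); ring.
apply: absconvex_balanced => //.
by rewrite nKM nKV nKRK_ge0 ?nK_ge0// divff ?gt_eqF.
Qed.

(** [D] is balanced, so its gauge is at least 1 at a point outside [D], and at most 1 on [D];
    Hahn-Banach for the gauge then gives [G]. *)
Lemma separation (v : V) : ~ D v ->
  exists G : V -> K, [/\ (forall l x y, G (l *: x + y) = l * G x + G y),
    (forall x, D x -> nK (G x) <= 1) & 1 <= nK (G v)].
Proof.
move=> Dv.
have gl : sublinear gauge.
  split=> [|r x r0]; first exact: gaugeD.
  by have := gaugeZ (RK r) x; rewrite (nKRK_ge0 (ltW r0)).
have [g [gD gZ gle gv]] := hahn_banach_real _ v gl.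
have [G [Glin Gle Gv]] := complexify _ _ _ _ _ v gD gZ gle gaugeZ.
exists G; split=> // [x Dx|].
  apply: le_trans (Gle x) _; apply: gauge_le => //.
  by rewrite invr1 RK1 scale1r.
apply: le_trans (Gv); apply: le_trans gv; apply: le_gauge => r r0 Dr.
rewrite leNgt; apply/negP => r1; apply: Dv.
have -> : v = RK r *: (RK r^-1 *: v).
  by rewrite scalerA -RKM divff ?gt_eqF// RK1 scale1r.
by apply: absconvex_balanced => //; rewrite nKRK_ge0 ltW.
Qed.

End Separation.

Lemma linear_row_sum (R : realType) (b : bool) (n : nat) (G : 'rV[Kf R b]_n -> Kf R b) y :
  (forall l x y, G (l *: x + y) = l * G x + G y) ->
  G y = \sum_(i < n) G (delta_mx 0 i) * y 0 i.
Proof.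
move=> Gl; have G0 : G 0 = 0.
  by have := Gl (-1) 0 0; rewrite scaler0 addr0 mulN1r addNr.
have GD x z : G (x + z) = G x + G z by have := Gl 1 x z; rewrite scale1r mul1r.
rewrite {1}[y]row_sum_delta (big_morph G GD G0); apply: eq_bigr => i _.
by have := Gl (y 0 i) (delta_mx 0 i) 0; rewrite !addr0 G0 addr0 mulrC.
Qed.

(** Separation in [K^n], applied to the points closer than [d] to the image of [B] in the maximum
    norm. The image contains 0, so the thickened set is absorbing. Absolute convexity is demanded of
    the image of [B], which lets [B] be any type of object. *)
Lemma finite_separation (R : realType) (b : bool) (X : Type) (B : set X) (n : nat)
    (F : 'I_n -> X -> Kf R b) (v : 'I_n -> Kf R b) (d : R) :
  0 < d -> B !=set0 ->
  (forall x y l m, B x -> B y -> nK l + nK m <= 1 ->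
     exists2 z, B z & forall i, F i z = l * F i x + m * F i y) ->
  (forall x, B x -> ~ (forall i, nK (v i - F i x) < d)) ->
  exists c : 'I_n -> Kf R b, (forall x, B x -> nK (\sum_i c i * F i x) <= 1) /\
    1 <= nK (\sum_i c i * v i).
Proof.
move=> d0 [x0 Bx0] Bconv Bv.
pose D : set 'rV[Kf R b]_n := [set y | exists2 x, B x & forall i, nK (y 0 i - F i x) < d].
have Dconv : absconvexE D.
  move=> y y' [x Bx yx] [x' Bx' yx'] l m lm.
  have [z Bz Fz] := Bconv x x' l m Bx Bx' lm; exists z => // i; rewrite !mxE Fz.
  have -> : l * y 0 i + m * y' 0 i - (l * F i x + m * F i x') =
    l * (y 0 i - F i x) + m * (y' 0 i - F i x') by ring.
  apply: le_lt_trans (nK_triangle _ _) _; rewrite !nKM.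
  (* For [l] nonzero the first term is strictly below [nK l * d]; for [l = 0] strictness comes from
     the second point. *)
  have [l0|l0] := eqVneq l 0; last first.
    apply: lt_le_trans (_ : nK l * d + nK m * d <= d).
      apply: ltr_leD; first by rewrite ltr_pM2l//; apply: nK_gt0; exact/eqP.
      by rewrite ler_wpM2l ?nK_ge0// ltW.
    by rewrite -mulrDl -[leRHS]mul1r ler_wpM2r// ltW.
  rewrite l0 nK0 mul0r add0r; move: lm; rewrite l0 nK0 add0r => m1.
  apply: le_lt_trans (yx' i); rewrite -[leRHS]mul1r ler_wpM2r//.
  exact: nK_ge0.
have Dabs y : exists2 r : R, 0 < r & D (RK b r *: y).
  have [z Bz Fz] := Bconv x0 x0 0 0 Bx0 Bx0 ltac:(by rewrite nK0 addr0).
  pose s := \sum_i nK (y 0 i).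
  have s0 : 0 <= s by apply: sumr_ge0 => i _; exact: nK_ge0.
  (* [s] dominates every coordinate, so this factor brings [y] within [d] of 0, the image of [z]. *)
  exists (d / (s + 1)); first by rewrite divr_gt0//; lra.
  exists z => // i; rewrite Fz !mul0r addr0 subr0 mxE nKM nKRK_ge0; last first.
    by rewrite divr_ge0 ?ltW//; lra.
  rewrite mulrAC -mulrA gtr_pMr// ltr_pdivrMr; last by lra.
  rewrite mul1r; suff : nK (y 0 i) <= s by lra.
  rewrite /s (bigD1 i)//= lerDl; apply: sumr_ge0 => j _; exact: nK_ge0.
have Dv : ~ D (\row_i v i).
  by move=> [x Bx h]; apply: (Bv x Bx) => i; have := h i; rewrite mxE.
have [G [Gl GD Gv]] := separation D Dconv Dabs _ Dv.
exists (fun i => G (delta_mx 0 i)); split=> [x Bx|].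
  have : D (\row_i F i x) by exists x => // i; rewrite mxE subrr nK0.
  move/GD; rewrite (linear_row_sum _ _ _ _ _ Gl).
  by under eq_bigr do rewrite mxE.
move: Gv; rewrite (linear_row_sum _ _ _ _ _ Gl).
by under eq_bigr do rewrite mxE.
Qed.

(** * Topologies given by families of seminorms *)

Lemma seqIn_cat (T : Type) (x : T) (s t : seq T) :
  seqIn x (s ++ t) <-> seqIn x s \/ seqIn x t.
Proof.
elim: s => [|y s IH] /=; first by split; [right|case].
by rewrite IH orA.
Qed.

Lemma seqIn_map (T U : Type) (f : T -> U) (x : T) (s : seq T) :
  seqIn x s -> seqIn (f x) (map f s).
Proof. by elim: s => //= y s IH [->|/IH]; [left|right]. Qed.

Lemma seqIn_tnth (T : Type) (x : T) (s : seq T) :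
  seqIn x s -> exists i, tnth (in_tuple s) i = x.
Proof.
elim: s => //= y s IH [->|/IH[i ix]]; first by exists ord0; rewrite (tnth_nth x).
by exists (lift ord0 i); rewrite -ix !(tnth_nth x).
Qed.

Lemma seqIn_upper_bound (R : realType) (I : Type) (F : seq I) (g : I -> R) :
  exists2 C, 0 < C & forall i, seqIn i F -> g i <= C.
Proof.
elim: F => [|i F [C C0 IH]]; first by exists 1.
exists (Num.max (g i) C); first by rewrite lt_max C0 orbT.
by move=> k /= [<-|/IH h]; rewrite le_max ?lexx// h orbT.
Qed.

Lemma seqIn_lower_bound (R : realType) (I : Type) (F : seq I) (g : I -> R) :
  (forall i, seqIn i F -> 0 < g i) ->
  exists2 e, 0 < e & forall i, seqIn i F -> e <= g i.
Proof.
move=> g0; have [C C0 H] := seqIn_upper_bound _ _ F (fun i => (g i)^-1).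
exists C^-1 => [|i Fi]; first by rewrite invr_gt0.
by rewrite -[g i]invrK lef_pV2 ?H// posrE ?invr_gt0 ?g0.
Qed.

Section SeminormFamily.
Context {R : realType} {V : zmodType} {I : Type} {q : I -> V -> R} {D : set V}.

(** Stated relative to the carrier [D] and without scalars, so that one theory serves [E], FV(Om),
    its dual and the epsilon product. Symmetry and nonnegativity follow from the rule for
    differences. *)
Definition seminorms_on (q : I -> V -> R) (D : set V) : Prop :=
  [/\ D 0, (forall x y, D x -> D y -> D (x - y)), (forall i, q i 0 = 0) &
      forall i x y, D x -> D y -> q i (x - y) <= q i x + q i y].

Hypothesis qD : seminorms_on q D.

Let D0 : D 0. Proof. by case: qD. Qed.
Let DB x y : D x -> D y -> D (x - y). Proof. by case: qD => _ h _ _; exact: h. Qed.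
Let q0 i : q i 0 = 0. Proof. by case: qD. Qed.
Let qB i x y : D x -> D y -> q i (x - y) <= q i x + q i y.
Proof. by case: qD => _ _ _ h; exact: h. Qed.

Lemma seminorms_on_opp x : D x -> D (- x).
Proof. by move=> Dx; rewrite -sub0r; exact: DB. Qed.

Lemma seminorms_on_add x y : D x -> D y -> D (x + y).
Proof. by move=> Dx Dy; rewrite -[y]opprK; apply: DB => //; exact: seminorms_on_opp. Qed.

Lemma seminorm_opp i x : D x -> q i (- x) <= q i x.
Proof. by move=> Dx; have := qB i 0 x D0 Dx; rewrite sub0r q0 add0r. Qed.

Lemma seminorm_triangle i x y : D x -> D y -> q i (x + y) <= q i x + q i y.
Proof.
move=> Dx Dy; have := qB i x (- y) Dx (seminorms_on_opp y Dy); rewrite opprK.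
by have := seminorm_opp i y Dy; lra.
Qed.

Lemma seminorm_ge0 i x : D x -> 0 <= q i x.
Proof. by move=> Dx; have := qB i x x Dx Dx; rewrite subrr q0; lra. Qed.

Lemma seminorm_chain i x y z : D x -> D y -> D z ->
  q i (z - x) <= q i (z - y) + q i (y - x).
Proof.
move=> Dx Dy Dz; have -> : z - x = (z - y) + (y - x) by rewrite addrA subrK.
by apply: seminorm_triangle; exact: DB.
Qed.

Lemma seminorm_distC i x y : D x -> D y -> q i (x - y) = q i (y - x).
Proof.
move=> Dx Dy; suff h u v : D u -> D v -> q i (u - v) <= q i (v - u).
  by apply/eqP; rewrite eq_le !h.
by move=> Du Dv; have := seminorm_opp i (v - u) (DB _ _ Dv Du); rewrite opprB.
Qed.

Lemma sball_center F x e : 0 < e -> sball q F x e x.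
Proof. by move=> e0 i _; rewrite subrr q0. Qed.

Lemma sopen_sball F x e : D x -> sopen q D (D `&` sball q F x e).
Proof.
move=> Dx; split=> [y [] //|y [Dy yx]]; exists F.
have [d d0 dle] := seqIn_lower_bound _ _ F (fun i => e - q i (y - x))
  ltac:(by move=> i Fi; rewrite subr_gt0; exact: yx).
exists d; split=> // z [Dz zy]; split=> // i Fi.
have := seminorm_chain i x y z Dx Dy Dz; have := zy i Fi; have := dle i Fi; lra.
Qed.

(** Compactness as an induction principle: the open sets with property [P] cover [B], and the union
    rule glues a finite subcover. *)
Lemma scompact_induction (B : set V) (P : set V -> Prop) : scompact q D B ->
  P set0 -> (forall X Y, X `<=` Y -> P Y -> P X) ->
  (forall X Y, P X -> P Y -> P (X `|` Y)) ->
  (forall x, B x -> exists F e, 0 < e /\ P (D `&` sball q F x e)) -> P B.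
Proof.
move=> [BD Bc] P0 Psub PU Ploc.
have [||s [sC /Psub]] := Bc [set U | sopen q D U /\ P U].
- by move=> U [].
- move=> x Bx; have [F [e [e0 PF]]] := Ploc x Bx.
  exists (D `&` sball q F x e); first by split=> //; exact/sopen_sball/BD.
  by split; [exact: BD|exact: sball_center].
apply; elim: s sC => [|U s IH] sC.
  by apply: Psub P0 => x [].
have PUs : P (U `|` \bigcup_(W in [set W | seqIn W s]) W).
  apply: PU; first by apply: (sC U _).2; left.
  by apply: IH => W sW; apply: sC; right.
apply: Psub PUs => x [W /= [<-|sW] Wx]; first by left.
by right; exists W.
Qed.

Lemma scompact_bounded (B : set V) i : scompact q D B ->
  exists C, forall x, B x -> q i x <= C.
Proof.
move=> Bc; apply: (scompact_induction _ (fun X => exists C, forall x, X x -> q i x <= C) Bc).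
- by exists 0.
- by move=> X Y XY [C h]; exists C => x /XY; exact: h.
- move=> X Y [C h] [C' h']; exists (Num.max C C') => x [/h|/h'] hx.
    by rewrite le_max hx.
  by rewrite le_max hx orbT.
- move=> x Bx; have Dx := Bc.1 x Bx.
  exists [:: i], 1; split=> //; exists (q i x + 1) => y [Dy yx].
  have := yx i (or_introl erefl).
  have := seminorm_chain i 0 x y D0 Dx Dy; rewrite !subr0; lra.
Qed.

(** The tube argument for a product, written as two nested compactness inductions. Sums will
    dominate finitely many kappa-seminorms by one. *)
Lemma scompact_add (B1 B2 : set V) : scompact q D B1 -> scompact q D B2 ->
  scompact q D [set z | exists x y, [/\ B1 x, B2 y & z = x + y]].
Proof.
move=> B1c B2c; split=> [_ [x [y [/B1c.1 Dx /B2c.1 Dy ->]]]|C Copen Ccov].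
  exact: seminorms_on_add.
pose fin (X : set V) := exists s : seq (set V), (forall U, seqIn U s -> C U) /\
      X `<=` \bigcup_(U in [set U | seqIn U s]) U.
have fin_sub X Y : X `<=` Y -> fin Y -> fin X.
  by move=> XY [s [sC sY]]; exists s; split=> // x /XY; exact: sY.
have finU X Y : fin X -> fin Y -> fin (X `|` Y).
  move=> [s [sC sX]] [t [tC tY]]; exists (s ++ t); split.
    by move=> U /seqIn_cat[/sC|/tC].
  move=> x [/sX|/tY] [U Us Ux]; exists U => //=; apply/seqIn_cat; by [left|right].
pose add (X Y : set V) := [set z | exists x y, [/\ X x, Y y & z = x + y]].
rewrite -/(add B1 B2) -/(fin _).
apply: (scompact_induction _ (fun X => fin (add X B2)) B1c).
- by exists nil; split=> // z [x [y []]].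
- by move=> X Y XY; apply: fin_sub => z [x [y [/XY Yx By ->]]]; exists x, y.
- move=> X Y fX fY; apply: fin_sub (finU _ _ fX fY) => z [x [y [[hx|hx] By ->]]].
    by left; exists x, y.
  by right; exists x, y.
move=> x B1x; have Dx := B1c.1 x B1x.
(* The ball around the fixed [x] may depend on the part of [B2]; for a union the two balls are
   intersected. *)
apply: (scompact_induction _
  (fun Y => exists F e, 0 < e /\ fin (add (D `&` sball q F x e) Y)) B2c).
- by exists nil, 1; split=> //; exists nil; split=> // z [? [? []]].
- move=> X Y XY [F [e [e0 h]]]; exists F, e; split=> //.
  by apply: fin_sub h => z [u [v [hu /XY Yv ->]]]; exists u, v.
- move=> X Y [F [e [e0 h]]] [F' [e' [e'0 h']]].
  exists (F ++ F'), (Num.min e e'); split; first by rewrite lt_min e0.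
  apply: fin_sub (finU _ _ h h') => z [u [v [[Du xu] [Xv|Yv] ->]]].
    left; exists u, v; split=> //; split=> // i Fi.
    have := xu i (proj2 (seqIn_cat _ _ _ _) (or_introl Fi)).
    by rewrite lt_min => /andP[].
  right; exists u, v; split=> //; split=> // i Fi.
  have := xu i (proj2 (seqIn_cat _ _ _ _) (or_intror Fi)).
  by rewrite lt_min => /andP[].
move=> y B2y; have Dy := B2c.1 y B2y.
have [U CU Uxy] := Ccov (x + y) ltac:(by exists x, y).
have [F [e [e0 FU]]] := (Copen U CU).2 _ Uxy.
exists F, (e / 2); split; first by rewrite divr_gt0.
exists F, (e / 2); split; first by rewrite divr_gt0.
exists [:: U]; split=> [W /= [<-|]//|z [u [v [[Du ux] [Dv vy] ->]]]].
exists U; first by left.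
apply: FU; split; first exact: seminorms_on_add.
move=> i Fi; have -> : u + v - (x + y) = (u - x) + (v - y) by rewrite opprD addrACA.
have := seminorm_triangle i (u - x) (v - y) (DB _ _ Du Dx) (DB _ _ Dv Dy).
by have := ux i Fi; have := vy i Fi; lra.
Qed.

Lemma sclosure_closed (A : set V) : A `<=` D -> sclosed q D (sclosure q D A).
Proof.
move=> AD; split=> [x [] //|x [Dx xcl]]; split=> // F e e0.
have e20 : 0 < e / 2 by rewrite divr_gt0.
have [y [[Dy ycl] yx]] := xcl F _ e20; have [z [Az zy]] := ycl F _ e20.
exists z; split=> // i Fi.
have := seminorm_chain i x y z Dx Dy (AD _ Az).
by have := yx i Fi; have := zy i Fi; lra.
Qed.

Lemma subset_sclosure (A : set V) : A `<=` D -> A `<=` sclosure q D A.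
Proof.
move=> AD x Ax; split=> [|F e e0]; first exact: AD.
by exists x; split=> //; exact: sball_center.
Qed.

Lemma sdirected_seq (F : seq I) : inhabited I -> sdirected q D ->
  exists i C, 0 < C /\ forall k x, seqIn k F -> D x -> q k x <= C * q i x.
Proof.
move=> [i0] qdir; elim: F => [|k F [i [C [C0 IH]]]]; first by exists i0, 1.
have [j [C' [C'0 H]]] := qdir i k.
(* The factor covers both cases: [C'] handles [k], and [C * C'] the earlier members. *)
exists j, ((C + 1) * C'); split; first by rewrite mulr_gt0//; lra.
move=> k' x kF Dx; have := H x Dx; rewrite ge_max => /andP[ij kj].
have j0 : 0 <= C' * q j x by rewrite mulr_ge0 ?seminorm_ge0// ltW.
case: kF => [<-|/IH/(_ Dx) h].
  by apply: le_trans kj _; rewrite -mulrA mulrDl mul1r lerDr mulr_ge0// ltW.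
apply: le_trans h _; rewrite -mulrA mulrDl mul1r.
apply: le_trans (_ : C * (C' * q j x) <= _); last by rewrite lerDl.
by rewrite ler_pM2l.
Qed.

(** Continuity at 0; for a seminorm composed with an additive map it amounts to continuity of the
    map. *)
Definition cont0 (q : I -> V -> R) (D : set V) (s : V -> R) : Prop :=
  forall e, 0 < e -> exists F d, 0 < d /\
    forall x, D x -> (forall i, seqIn i F -> q i x < d) -> s x < e.

Lemma cont0_seqIn (T : Type) (s : T -> V -> R) (L : seq T) (e : R) :
  (forall t, cont0 q D (s t)) -> 0 < e -> exists F d, 0 < d /\
    forall x, D x -> (forall i, seqIn i F -> q i x < d) ->
      forall t, seqIn t L -> s t x < e.
Proof.
move=> sc e0; elim: L => [|t L [F [d [d0 IH]]]]; first by exists nil, 1.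
have [F' [d' [d'0 H]]] := sc t e e0.
exists (F' ++ F), (Num.min d' d); split; first by rewrite lt_min d'0.
move=> x Dx hx k /= [<-|Lk].
  apply: H => // i Fi.
  have := hx i (proj2 (seqIn_cat _ _ _ _) (or_introl Fi)).
  by rewrite lt_min => /andP[].
apply: IH => // i Fi.
have := hx i (proj2 (seqIn_cat _ _ _ _) (or_intror Fi)).
by rewrite lt_min => /andP[].
Qed.

Lemma cont0_axpy (s t : V -> R) c : 0 <= c -> cont0 q D s -> cont0 q D t ->
  cont0 q D (fun x => c * s x + t x).
Proof.
move=> c0 sc tc e e0; pose d := e / (c + 2).
have d0 : 0 < d by rewrite divr_gt0//; lra.
have [F [d' [d'0 H]]] := cont0_seqIn _ (fun z : bool => if z then s else t)
  [:: true; false] d ltac:(by case) d0.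
exists F, d'; split=> // x Dx hx.
have h1 := H x Dx hx true (or_introl erefl).
have h2 := H x Dx hx false (or_intror (or_introl erefl)).
have -> : e = c * d + d + d.
  by rewrite /d; field; apply: lt0r_neq0; lra.
by have := ler_wpM2l c0 (ltW h1); simpl in h2; lra.
Qed.

Lemma cont0_le (s t : V -> R) : (forall x, D x -> s x <= t x) ->
  cont0 q D t -> cont0 q D s.
Proof.
move=> st tc e e0; have [F [d [d0 H]]] := tc e e0; exists F, d; split=> // x Dx hx.
exact: le_lt_trans (st x Dx) (H x Dx hx).
Qed.

Lemma cont0_const0 : cont0 q D (fun=> 0).
Proof. by move=> e e0; exists nil, 1. Qed.

End SeminormFamily.

Section Continuity.
Context {R : realType} {V1 V2 : zmodType} {I1 I2 : Type}.
Context {q1 : I1 -> V1 -> R} {D1 : set V1} {q2 : I2 -> V2 -> R} {D2 : set V2}.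
Hypothesis qD1 : seminorms_on q1 D1.
Hypothesis qD2 : seminorms_on q2 D2.
Variable f : V1 -> V2.

Lemma cont0_scont : (forall x, D1 x -> D2 (f x)) ->
  (forall x y, D1 x -> D1 y -> f (x - y) = f x - f y) ->
  (forall i, cont0 q1 D1 (fun x => q2 i (f x))) -> scont q1 D1 q2 D2 f.
Proof.
move=> fD fB fc; split=> // U [UD Uo]; split=> [x [] //|x [Dx Ufx]].
have [F [e [e0 FU]]] := Uo _ Ufx.
have [F' [d [d0 H]]] := cont0_seqIn _ (fun i x => q2 i (f x)) F e fc e0.
exists F', d; split=> // y [Dy yx]; split=> //=; apply: FU; split; first exact: fD.
move=> i Fi; rewrite -fB//; apply: H => //.
by case: qD1 => _ DB _ _; exact: DB.
Qed.

Lemma scont_cont0 : f 0 = 0 -> scont q1 D1 q2 D2 f ->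
  forall i, cont0 q1 D1 (fun x => q2 i (f x)).
Proof.
move=> f0 [fD fc] i e e0.
have D20 : D2 0 by case: qD2.
have D10 : D1 0 by case: qD1.
have [_] := fc _ (sopen_sball qD2 [:: i] 0 e D20).
case/(_ 0).
  by split=> //=; rewrite f0; split=> //; exact: (sball_center qD2).
move=> F [d [d0 H]]; exists F, d; split=> // x Dx hx.
have [|_ [_]] := H x; first by split=> // k Fk; rewrite subr0; exact: hx.
by move=> /(_ i (or_introl erefl)); rewrite subr0.
Qed.

End Continuity.

(** * The dual of a locally convex space *)

Section Dual.
Context {R : realType} {b : bool} {E : lmodType (Kf R b)} {A : Type} {p : A -> E -> R}.
Local Notation K := (Kf R b).
Local Notation nK := (@nK R b).
Local Notation RK := (@RK R b).
Hypothesis p_seminorm : forall a, is_seminorm (p a).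

Lemma seminormZ a l x : p a (l *: x) = nK l * p a x.
Proof. by case: (p_seminorm a) => _ []. Qed.

Lemma seminorms_on_E : seminorms_on p setT.
Proof.
split=> // [a|a x y _ _]; first by rewrite -(scale0r (0 : E)) seminormZ nK0 mul0r.
have [_ [pD _]] := p_seminorm a.
by rewrite -scaleN1r (le_trans (pD _ _))// seminormZ nKN nK1 mul1r.
Qed.

Lemma seminorms_on_K : seminorms_on (@qK R b) setT.
Proof.
split=> // [i|i x y _ _]; first exact: nK0.
by apply: le_trans (nK_triangle _ _) _; rewrite nKN.
Qed.

Lemma EdualP (e' : E -> K) :
  Edual p e' <-> (forall (l : K) x y, e' (l *: x + y) = l * e' x + e' y) /\
    cont0 p setT (fun x => nK (e' x)).
Proof.
split=> -[lin ct]; split=> //.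
  apply: (scont_cont0 seminorms_on_E seminorms_on_K e' _ ct tt).
  by have := lin (-1) 0 0; rewrite scaler0 addr0 mulN1r addNr.
apply: (cont0_scont seminorms_on_E) => // x y _ _.
by rewrite addrC -scaleN1r lin mulN1r addrC.
Qed.

Section Element.
Context {e' : E -> K}.
Hypothesis e'_dual : Edual p e'.

Lemma Edual0 : e' 0 = 0.
Proof. by have := e'_dual.1 (-1) 0 0; rewrite scaler0 addr0 mulN1r addNr. Qed.

Lemma EdualZ l x : e' (l *: x) = l * e' x.
Proof. by have := e'_dual.1 l x 0; rewrite Edual0 !addr0. Qed.

Lemma EdualB x y : e' (x - y) = e' x - e' y.
Proof. by rewrite addrC -scaleN1r e'_dual.1 mulN1r addrC. Qed.

End Element.

Lemma Edual_axpy l e1 e2 : Edual p e1 -> Edual p e2 ->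
  Edual p (fun x => l * e1 x + e2 x).
Proof.
move=> /EdualP[l1 c1] /EdualP[l2 c2]; apply/EdualP; split=> [k x y|].
  by rewrite l1 l2; ring.
apply: cont0_le (cont0_axpy _ _ _ (nK_ge0 l) c1 c2) => x _.
by rewrite -nKM; exact: nK_triangle.
Qed.

Lemma Edual_const0 : Edual p (fun=> 0).
Proof.
apply/EdualP; split=> [l x y|]; first by rewrite mulr0 addr0.
by apply: cont0_le cont0_const0 => x _; rewrite nK0.
Qed.

(** Boundedness on the unit ball of [p a] makes a linear functional continuous: the factor [2 / e]
    takes the ball of radius [e / 2] to the unit ball. *)
Lemma polarB_bound (G : E -> K) a :
  (forall l x y, G (l *: x + y) = l * G x + G y) ->
  (forall x, p a x < 1 -> nK (G x) <= 1) -> polarB p a G.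
Proof.
move=> Glin Gle; split=> //; apply/EdualP; split=> // e e0.
have G0 : G 0 = 0 by have := Glin (-1) 0 0; rewrite scaler0 addr0 mulN1r addNr.
exists [:: a], (e / 2); split; first by rewrite divr_gt0.
move=> x _ /(_ a (or_introl erefl)) pax.
have e20 : 0 < 2 / e by rewrite divr_gt0.
have := Gle (RK (2 / e) *: x); rewrite seminormZ (nKRK_ge0 (ltW e20)).
have -> : G (RK (2 / e) *: x) = RK (2 / e) * G x.
  by have := Glin (RK (2 / e)) x 0; rewrite G0 !addr0.
rewrite nKM (nKRK_ge0 (ltW e20)) -ltr_pdivlMl// -ler_pdivlMl// !mulr1 invf_div.
by move=> /(_ pax) h; apply: le_lt_trans h _; lra.
Qed.

Lemma polarB_le a e' x : polarB p a e' -> nK (e' x) <= p a x.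
Proof.
move=> [e'd e'1]; apply/ler_addgt0Pr => e e0.
have t0 : 0 < p a x + e by have [p0 _] := p_seminorm a; have := p0 x; lra.
have tV : 0 <= (p a x + e)^-1 by rewrite invr_ge0 ltW.
have := e'1 (RK (p a x + e)^-1 *: x).
rewrite seminormZ (EdualZ e'd) nKM (nKRK_ge0 tV) ltr_pdivrMl// ler_pdivrMl// mulr1.
by apply; rewrite ltrDl.
Qed.

(** If [p a x] exceeded [r], then [x / s] with [s] halfway between them would lie outside the open
    unit ball; the functional separating it from the ball is in the polar and has modulus at least
    [s > r] at [x]. *)
Lemma le_polarB a x r : (forall e', polarB p a e' -> nK (e' x) <= r) -> p a x <= r.
Proof.
move=> h; have r0 : 0 <= r.
  have := h (fun=> 0); rewrite nK0; apply; split; first exact: Edual_const0.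
  by move=> y _; rewrite nK0.
rewrite leNgt; apply/negP => rp; pose s := (r + p a x) / 2.
have s0 : 0 < s by rewrite /s; lra.
pose D := [set y | p a y < 1].
have Dconv : absconvexE D.
  move=> y z /= Dy Dz l m lm; pose M := Num.max (p a y) (p a z).
  apply: le_lt_trans (_ : M < 1); last by rewrite gt_max Dy.
  have [p0 [pD _]] := p_seminorm a.
  apply: le_trans (pD _ _) _; rewrite !seminormZ.
  apply: le_trans (_ : nK l * M + nK m * M <= M).
    by rewrite lerD// ler_wpM2l ?nK_ge0// le_max lexx ?orbT.
  by rewrite -mulrDl -[leRHS]mul1r ler_wpM2r// le_max p0.
have Dabs y : exists2 t : R, 0 < t & D (RK t *: y).
  have [p0 _] := p_seminorm a; have py := p0 y.
  have t0 : 0 < (p a y + 1)^-1 by rewrite invr_gt0; lra.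
  exists (p a y + 1)^-1 => //; rewrite /D /= seminormZ (nKRK_ge0 (ltW t0)).
  by rewrite mulrC ltr_pdivrMr ?mul1r; lra.
have Dv : ~ D (RK s^-1 *: x).
  rewrite /D /= seminormZ nKRK_ge0 ?invr_ge0 ?(ltW s0)// mulrC.
  by rewrite ltr_pdivrMr// mul1r /s; lra.
have [G [Glin GD Gv]] := separation D Dconv Dabs _ Dv.
have Gpol := polarB_bound G a Glin GD.
have := h G Gpol; move: Gv; rewrite (EdualZ Gpol.1) nKM nKRK_ge0 ?invr_ge0 ?(ltW s0)//.
by rewrite mulrC ler_pdivlMr// mul1r /s; lra.
Qed.

Hypothesis p_directed : sdirected p setT.
Hypothesis p_hausdorff : shausdorff p setT.

Lemma hausdorff_separated x : x <> 0 -> exists a, p a x <> 0.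
Proof.
move=> /eqP x0; apply: contrapT => /forallNP h.
have [U [W [[_ Uo] [_ [Ux [W0 UW]]]]]] := p_hausdorff x 0 Logic.I Logic.I ltac:(exact/eqP).
have [F [e [e0 FU]]] := Uo x Ux.
suff : (U `&` W) 0 by rewrite UW.
split=> //; apply: FU; split=> // a _; rewrite sub0r -scaleN1r seminormZ.
by have /contrapT -> := h a; rewrite mulr0.
Qed.

Lemma Edual_eq x y : (forall e', Edual p e' -> e' x = e' y) -> x = y.
Proof.
move=> h; apply/eqP; rewrite -subr_eq0; apply/eqP; apply: contrapT => /hausdorff_separated[a].
apply; apply/eqP; rewrite eq_le; apply/andP; split; last by case: (p_seminorm a).
by apply: le_polarB => e' [/[dup] e'd /h he _]; rewrite (EdualB e'd) he subrr nK0.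
Qed.

Lemma Edual_bounded e' : inhabited A -> Edual p e' ->
  exists a C, 0 < C /\ forall x, nK (e' x) <= C * p a x.
Proof.
move=> Ai e'd; have [_ ct] := proj1 (EdualP _) e'd.
have [F [d [d0 H]]] := ct 1 ltr01.
have [a [C [C0 HC]]] := sdirected_seq seminorms_on_E F Ai p_directed.
exists a, (C / d); split=> [|x]; first by rewrite divr_gt0.
apply/ler_addgt0Pr => e e0; have [p0 _] := p_seminorm a; have px := p0 x.
(* The summand [e] keeps the divisor positive when [p a x = 0]. *)
pose t := C / d * p a x + e.
have t0 : 0 < t.
  by rewrite /t ltr_wpDl// mulr_ge0// ltW// divr_gt0.
have := H (RK t^-1 *: x) Logic.I; rewrite (EdualZ e'd) nKM nKRK_ge0 ?invr_ge0 ?(ltW t0)//.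
rewrite [_ * nK _]mulrC ltr_pdivrMr// mul1r => h; apply/ltW/h => i Fi.
rewrite seminormZ nKRK_ge0 ?invr_ge0 ?(ltW t0)// mulrC ltr_pdivrMr//.
apply: le_lt_trans (HC i x Fi Logic.I) _.
rewrite -ltr_pdivrMl// /t mulrA [_^-1 * C]mulrC.
by rewrite ltrDl.
Qed.

(** Every functional is a multiple of a member of some polar, so what is known on polars reaches all
    of [E'] by scaling. *)
Lemma Edual_polarB e' : inhabited A -> Edual p e' ->
  exists a C, 0 < C /\ polarB p a (fun x => RK C * e' x).
Proof.
move=> Ai e'd; have [a [C [C0 H]]] := Edual_bounded e' Ai e'd.
have CV : 0 <= C^-1 by rewrite invr_ge0 ltW.
exists a, C^-1; split; first by rewrite invr_gt0.
apply: polarB_bound => [l x y|x px]; first by rewrite e'd.1; ring.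
rewrite nKM (nKRK_ge0 CV) ler_pdivrMl// mulr1.
by apply: le_trans (H x) _; rewrite -[leRHS]mulr1 ler_pM2l// ltW.
Qed.

End Dual.

(** * The scalar valued space and its dual *)

(** [sup] is 0 on the empty set, whence the condition [0 <= c]. *)
Lemma sup_le_nonneg (R : realType) (X : set R) (c : R) :
  0 <= c -> (forall x, X x -> x <= c) -> sup X <= c.
Proof.
move=> c0 Xc; have [[x Xx]|X0] := pselect (exists x, X x).
  by apply: ge_sup => //; exists x.
by rewrite sup_out// => -[[x Xx] _]; apply: X0; exists x.
Qed.

Section ScalarFV.
Context {R : realType} {b : bool} {Om J M : Type} {om : M -> Type}
  {nu : J -> forall m : M, om m -> R}
  {APK : set (Om -> Kf R b)} {domTK : forall m : M, set (Om -> Kf R b)}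
  {TK : forall m : M, (Om -> Kf R b) -> (om m -> Kf R b)}.
Local Notation K := (Kf R b).
Local Notation nK := (@nK R b).
Local Notation RK := (@RK R b).
Local Notation FV := (FVK nu APK domTK TK).
Local Notation sem := (semFVK nu TK).
Local Notation FV' := (FVdual nu APK domTK TK).
Local Notation kidx := (kappa_idx nu APK domTK TK).
Local Notation semk := (@semKappa R b Om J M om nu APK domTK TK).

Hypothesis om_inhabited : forall m, inhabited (om m).
Hypothesis nu_ge0 : forall j m x, 0 <= nu j m x.
Hypothesis nu_gt0 : forall m (x : om m), exists j, 0 < nu j m x.
Hypothesis APK_sub : lsubK APK.
Hypothesis domTK_sub : forall m, lsubK (domTK m).
Hypothesis TK_linear : forall m (l : K) f g, domTK m f -> domTK m g ->
      TK m (fun w => l * f w + g w) = (fun x => l * TK m f x + TK m g x).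

Lemma TK_const0 m : TK m (fun=> 0) = (fun=> 0).
Proof.
have d0 := (domTK_sub m).1; have := TK_linear m (-1) _ _ d0 d0.
have -> : (fun w : Om => -1 * 0 + 0) = (fun=> 0 : K).
  by apply/funext => w; rewrite mulr0 addr0.
by move=> ->; apply/funext => x; rewrite mulN1r addNr.
Qed.

Lemma FVK_axpy l f g : FV f -> FV g -> FV (fun w => l * f w + g w).
Proof.
move=> [Af hf] [Ag hg]; split=> [|m]; first exact: APK_sub.2.
have [df bf] := hf m; have [dg bg] := hg m.
split=> [|j]; first exact: (domTK_sub m).2.
have [Cf Hf] := bf j; have [Cg Hg] := bg j; exists (nK l * Cf + Cg) => x.
rewrite TK_linear//; apply: le_trans (_ : (nK l * nK (TK m f x) + nK (TK m g x)) * nu j m x <= _).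
  by rewrite ler_wpM2r// -nKM; exact: nK_triangle.
by rewrite mulrDl lerD// -mulrA ler_wpM2l// nK_ge0.
Qed.

Lemma FVK_const0 : FV (fun=> 0).
Proof.
split=> [|m]; first exact: APK_sub.1.
split=> [|j]; first exact: (domTK_sub m).1.
by exists 0 => x; rewrite TK_const0 nK0 mul0r.
Qed.

Lemma TK_le_sem f j m x : FV f -> nK (TK m f x) * nu j m x <= sem (j, m) f.
Proof.
move=> [_ /(_ m)[_ /(_ j)[C HC]]]; apply: ub_le_sup; last by exists x.
by exists C => _ [y _ <-].
Qed.

Lemma sem_le f j m c : (forall x, nK (TK m f x) * nu j m x <= c) -> sem (j, m) f <= c.
Proof.
move=> h; apply: ge_sup; last by move=> _ [x _ <-].
by have [x] := om_inhabited m; exists (nK (TK m f x) * nu j m x), x.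
Qed.

Lemma sem_axpy i l f g : FV f -> FV g ->
  sem i (fun w => l * f w + g w) <= nK l * sem i f + sem i g.
Proof.
case: i => j m Ff Fg; apply: sem_le => x; rewrite TK_linear; last 2 first.
- by case: Ff => _ /(_ m)[].
- by case: Fg => _ /(_ m)[].
apply: le_trans (_ : (nK l * nK (TK m f x) + nK (TK m g x)) * nu j m x <= _).
  by rewrite ler_wpM2r// -nKM; exact: nK_triangle.
rewrite mulrDl lerD ?TK_le_sem// -mulrA ler_wpM2l ?nK_ge0//.
exact: TK_le_sem.
Qed.

Lemma fct_subE (f g : Om -> K) : f - g = (fun w => -1 * g w + f w).
Proof. by apply/funext => w; rewrite mulN1r addrC. Qed.

Lemma fct0E : 0 = (fun=> 0) :> (Om -> K).
Proof. by []. Qed.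

Lemma sem_const0 i : sem i (fun=> 0) = 0.
Proof.
case: i => j m; apply/eqP; rewrite eq_le; apply/andP; split.
  by apply: sem_le => x; rewrite TK_const0 nK0 mul0r.
have [x] := om_inhabited m; have := TK_le_sem _ j m x FVK_const0.
by rewrite TK_const0 nK0 mul0r.
Qed.

Lemma seminorms_on_FVK : seminorms_on sem FV.
Proof.
split; [exact: FVK_const0| |exact: sem_const0|].
  by move=> f g Ff Fg; rewrite fct_subE; exact: FVK_axpy.
move=> i f g Ff Fg; rewrite fct_subE (le_trans (sem_axpy _ _ _ _ _ _))//.
by rewrite nKN nK1 mul1r addrC.
Qed.

Lemma FVK_scale l f : FV f -> FV (fun w => l * f w).
Proof.
move=> Ff; have -> : (fun w => l * f w) = (fun w => l * f w + 0).
  by apply/funext => w; rewrite addr0.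
by apply: FVK_axpy => //; exact: FVK_const0.
Qed.

Lemma sem_scale i l f : FV f -> sem i (fun w => l * f w) <= nK l * sem i f.
Proof.
move=> Ff; have -> : (fun w => l * f w) = (fun w => l * f w + 0).
  by apply/funext => w; rewrite addr0.
by have := sem_axpy i l f _ Ff FVK_const0; rewrite sem_const0 addr0.
Qed.

Section DualElement.
Context {f' : (Om -> K) -> K}.
Hypothesis f'_dual : FV' f'.

Lemma FVdual_const0 : f' (fun=> 0) = 0.
Proof.
have := f'_dual.1 (-1) _ _ FVK_const0 FVK_const0.
have -> : (fun w : Om => -1 * 0 + 0) = (fun=> 0 : K).
  by apply/funext => w; rewrite mulr0 addr0.
by move=> ->; rewrite mulN1r addNr.
Qed.

Lemma FVdual_scale l f : FV f -> f' (fun w => l * f w) = l * f' f.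
Proof.
move=> Ff; have := f'_dual.1 l f _ Ff FVK_const0; rewrite FVdual_const0 addr0 => <-.
by congr f'; apply/funext => w; rewrite addr0.
Qed.

Lemma FVdual_sub f g : FV f -> FV g -> f' (f - g) = f' f - f' g.
Proof. by move=> Ff Fg; rewrite fct_subE f'_dual.1// mulN1r addrC. Qed.

End DualElement.

Lemma FVdualP f' : FV' f' <->
  (forall (l : K) f g, FV f -> FV g -> f' (fun w => l * f w + g w) = l * f' f + f' g) /\
  cont0 sem FV (fun f => nK (f' f)).
Proof.
split=> -[lin ct]; split=> //.
  apply: (scont_cont0 seminorms_on_FVK seminorms_on_K f' _ ct tt).
  exact: (FVdual_const0 (conj lin ct)).
apply: (cont0_scont seminorms_on_FVK) => // x y Fx Fy.
by rewrite fct_subE lin// mulN1r addrC.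
Qed.

Lemma FVdual_axpy l f' g' : FV' f' -> FV' g' -> FV' (fun f => l * f' f + g' f).
Proof.
move=> /FVdualP[l1 c1] /FVdualP[l2 c2]; apply/FVdualP; split=> [k f g Ff Fg|].
  by rewrite l1// l2//; ring.
apply: cont0_le (cont0_axpy _ _ _ (nK_ge0 l) c1 c2) => x _.
by rewrite -nKM; exact: nK_triangle.
Qed.

Lemma FVdual_zero : FV' (fun=> 0).
Proof.
apply/FVdualP; split=> [l x y _ _|]; first by rewrite mulr0 addr0.
by apply: cont0_le cont0_const0 => x _; rewrite nK0.
Qed.

Lemma functional_subE (f' g' : (Om -> K) -> K) : f' - g' = (fun f => -1 * g' f + f' f).
Proof. by apply/funext => f; rewrite mulN1r addrC. Qed.

Lemma FVdual_subfunctional f' g' : FV' f' -> FV' g' -> FV' (f' - g').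
Proof. by move=> Ff' Fg'; rewrite functional_subE; exact: FVdual_axpy. Qed.

(** * Equicontinuity and the topology kappa *)

Definition equi0 (H : set ((Om -> K) -> K)) : Prop :=
  forall e, 0 < e -> exists F d, 0 < d /\ forall f' f, H f' -> FV f ->
    (forall i, seqIn i F -> sem i f < d) -> nK (f' f) < e.

Lemma equicontP H : equicont nu APK domTK TK H <-> H `<=` FV' /\ equi0 H.
Proof.
split=> -[HF' He]; split=> //.
  move=> e e0; have [U [[_ Uo] [U0 hU]]] := He _ FVK_const0 e e0.
  have [F [d [d0 FU]]] := Uo _ U0; exists F, d; split=> // f' f Hf' Ff fd.
  have := hU f' f Hf'; rewrite (FVdual_const0 (HF' _ Hf')) subr0; apply.
  by apply: FU; split=> // i Fi; rewrite -fct0E subr0; exact: fd.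
move=> f0 Ff0 e e0; have [F [d [d0 H0]]] := He e e0.
exists (FV `&` sball sem F f0 d); split; first exact: (sopen_sball seminorms_on_FVK).
split; first by split=> //; exact: (sball_center seminorms_on_FVK).
move=> f' f Hf' [Ff fd]; rewrite -(FVdual_sub (HF' _ Hf'))//; apply: H0 => //.
by case: seminorms_on_FVK => _ DB _ _; exact: DB.
Qed.

Lemma FVdual_equi0 f' : FV' f' -> equi0 [set f'].
Proof.
move=> /FVdualP[_ ct] e e0; have [F [d [d0 H]]] := ct e e0.
by exists F, d; split=> // _ f -> ; exact: H.
Qed.

(** After division by [t = 2 * C / d] every member of [B] falls into the neighbourhood of 0 on which
    [H] is bounded by 1. This makes the suprema in [semKappa] and [semEps] finite. *)
Lemma equi0_bounded H B : equi0 H -> H `<=` FV' -> scompact sem FV B ->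
  exists C, 0 < C /\ forall f' f, H f' -> B f -> nK (f' f) <= C.
Proof.
move=> He HF' Bc; have [F [d [d0 H1]]] := He 1 ltr01.
have [c hc] := choice (fun i => scompact_bounded seminorms_on_FVK B i Bc).
have [C C0 cC] := seqIn_upper_bound _ _ F c.
pose t := 2 * C / d; have t0 : 0 < t by rewrite divr_gt0 ?mulr_gt0.
have tV : 0 <= t^-1 by rewrite invr_ge0 ltW.
exists t; split=> // f' f Hf' Bf; have Ff := Bc.1 _ Bf.
have := H1 f' _ Hf' (FVK_scale (RK t^-1) f Ff).
rewrite (FVdual_scale (HF' _ Hf'))// nKM (nKRK_ge0 tV) ltr_pdivrMl// mulr1.
move=> h; apply/ltW/h => i Fi; apply: le_lt_trans (sem_scale _ _ _ Ff) _.
rewrite (nKRK_ge0 tV) ltr_pdivrMl//; apply: le_lt_trans (hc i f Bf) _.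
apply: le_lt_trans (cC i Fi) _; rewrite /t divfK ?gt_eqF//; lra.
Qed.

Lemma semKappa_ge (B : kidx) f' f : FV' f' -> sval B f -> nK (f' f) <= semk B f'.
Proof.
move=> Ff' Bf; apply: ub_le_sup; last by exists f.
have [C [_ HC]] := equi0_bounded _ _ (FVdual_equi0 _ Ff')
   ltac:(by move=> _ ->) (svalP B).2.
by exists C => _ [g Bg <-]; exact: HC.
Qed.

Lemma semKappa_le (B : kidx) f' c : 0 <= c ->
  (forall f, sval B f -> nK (f' f) <= c) -> semk B f' <= c.
Proof. by move=> c0 h; apply: sup_le_nonneg => // _ [f Bf <-]; exact: h. Qed.

Lemma semKappa_ge0 (B : kidx) f' : FV' f' -> 0 <= semk B f'.
Proof.
move=> Ff'; have [[f Bf]|B0] := pselect (exists f, sval B f).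
  exact: le_trans (nK_ge0 _) (semKappa_ge _ _ _ Ff' Bf).
by rewrite /semKappa sup_out// => -[[_ [f Bf _]] _]; apply: B0; exists f.
Qed.

Lemma seminorms_on_kappa : seminorms_on semk FV'.
Proof.
split; [exact: FVdual_zero|exact: FVdual_subfunctional| |].
  move=> B; apply/eqP; rewrite eq_le semKappa_ge0 ?andbT; last exact: FVdual_zero.
  by apply: semKappa_le => // f _; rewrite nK0.
move=> B f' g' Ff' Fg'; apply: semKappa_le => [|f Bf].
  by rewrite addr_ge0 ?semKappa_ge0.
apply: le_trans (nK_triangle _ _) _.
by rewrite nKN lerD// semKappa_ge.
Qed.

Lemma semKappa_scale B l f' : FV' f' -> semk B (fun f => l * f' f) <= nK l * semk B f'.
Proof.
move=> Ff'; apply: semKappa_le => [|f Bf].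
  by rewrite mulr_ge0 ?nK_ge0 ?semKappa_ge0.
by rewrite nKM ler_wpM2l ?nK_ge0// semKappa_ge.
Qed.

Lemma semKappa_sub (B B' : kidx) f' : FV' f' -> sval B `<=` sval B' ->
  semk B f' <= semk B' f'.
Proof.
move=> Ff' BB'; apply: semKappa_le; first exact: semKappa_ge0.
by move=> f /BB'; exact: semKappa_ge.
Qed.

Definition mk_kappa (B : set (Om -> K)) (ac : absconvexK B) (cp : scompact sem FV B) : kidx :=
  exist (fun B => absconvexK B /\ scompact sem FV B) B (conj ac cp).

(** A sum of absolutely convex compact sets contains its summands once both contain 0, so 0 is
    carried along in the induction; an empty set among the indices is skipped. *)
Lemma kappa_directed (L : seq kidx) : exists B : kidx,
  forall B', seqIn B' L -> sval B' `<=` sval B.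
Proof.
suff [B B0 HB] : exists2 B : kidx, sval B (fun=> 0) &
    forall B', seqIn B' L -> sval B' `<=` sval B by exists B.
elim: L => [|B' L [B B0 IH]].
  have ac : absconvexK [set (fun=> 0 : K) : Om -> K].
    by move=> f g -> -> l m _; apply/funext => w; rewrite !mulr0 addr0.
  have cp : scompact sem FV [set (fun=> 0 : K) : Om -> K].
    split=> [_ ->|C _ CU]; first exact: FVK_const0.
    have [U CU' U0] := CU _ erefl; exists [:: U]; split=> [W [<-|]//|_ ->].
    by exists U => //; left.
  by exists (mk_kappa _ ac cp).
have [[f B'f]|B'0] := pselect (exists f, sval B' f); last first.
  exists B => // B'' [<-|/IH//] f Bf; by case: B'0; exists f.
have [[acB cpB] [acB' cpB']] := (svalP B, svalP B').
have B'1 : sval B' (fun=> 0).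
  have := acB' f f B'f B'f 0 0; rewrite nK0 addr0 => /(_ ler01).
  by congr (sval B' _); apply/funext => w; rewrite !mul0r addr0.
have cp := scompact_add seminorms_on_FVK _ _ cpB cpB'.
have ac : absconvexK [set z | exists x y : Om -> K, [/\ sval B x, sval B' y & z = x + y]].
  move=> _ _ [x [y [Bx By ->]]] [x' [y' [Bx' By' ->]]] l m lm.
  exists (fun w => l * x w + m * x' w), (fun w => l * y w + m * y' w).
  split; [exact: acB|exact: acB'|].
  by apply/funext => w /=; rewrite !fctE !mulrDr addrACA.
exists (mk_kappa _ ac cp) => /=.
  by exists (fun=> 0), (fun=> 0); split=> //; apply/funext => w; rewrite fctE addr0.
move=> B'' [<-|/IH BB] g B''g.
  by exists (fun=> 0), g; split=> //; apply/funext => w; rewrite fctE add0r.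
by exists g, (fun=> 0); split=> //; [exact: BB|apply/funext => w; rewrite fctE addr0].
Qed.

(** * Density of the point evaluations *)

Hypothesis delta_dual : forall x, FV' (@delta R b Om x).

(* On a compact set the topology of pointwise convergence, being Hausdorff,
   is not coarser than the given one. *)
Lemma scompact_pointwise B f' e : scompact sem FV B -> FV' f' -> 0 < e ->
  exists ws d, 0 < d /\ forall f, B f ->
    (forall w, seqIn w ws -> nK (f w) < d) -> nK (f' f) < e.
Proof.
move=> Bc Ff' e0; apply: (scompact_induction seminorms_on_FVK _
  (fun X => exists ws d, 0 < d /\ forall f, X f ->
    (forall w, seqIn w ws -> nK (f w) < d) -> nK (f' f) < e) Bc).
- by exists nil, 1.
- by move=> X Y XY [ws [d [d0 h]]]; exists ws, d; split=> // f /XY; exact: h.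
- move=> X Y [ws [d [d0 h]]] [ws' [d' [d'0 h']]].
  exists (ws ++ ws'), (Num.min d d'); split; first by rewrite lt_min d0.
  move=> f [Xf|Yf] fw.
    apply: h => // w hw; have := fw w (proj2 (seqIn_cat _ _ _ _) (or_introl hw)).
    by rewrite lt_min => /andP[].
  apply: h' => // w hw; have := fw w (proj2 (seqIn_cat _ _ _ _) (or_intror hw)).
  by rewrite lt_min => /andP[].
(* Near 0 continuity of [f'] suffices. Near [g] with [g w <> 0] the ball keeps [f w] within
   [nK (g w) / 2] of [g w], so [nK (f w) < nK (g w) / 2] is impossible. *)
move=> g Bg; have [->|/eqP g0] := pselect (g = 0).
  have [F [d [d0 H]]] := (proj1 (FVdualP _) Ff').2 e e0.
  exists F, d; split=> //; exists nil, 1; split=> // f [Ff fd] _.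
  by apply: H => // i Fi; have := fd i Fi; rewrite subr0.
have [w gw] : exists w, g w <> 0.
  apply: contrapT => /forallNP h; move/eqP: g0; apply; apply/funext => w.
  by have /contrapT := h w.
have n0 : 0 < nK (g w) / 2 by rewrite divr_gt0// nK_gt0.
have [F [d [d0 H]]] := (proj1 (FVdualP _) (delta_dual w)).2 _ n0.
exists F, d; split=> //; exists [:: w], (nK (g w) / 2); split=> // f [Ff fd].
move=> /(_ w (or_introl erefl)) fw; exfalso.
have Fg : FV g by exact: Bc.1.
have := H (f - g) ltac:(by case: seminorms_on_FVK => _ DB _ _; exact: DB) fd.
rewrite /delta; have -> : (f - g) w = f w - g w by [].
have := nK_triangle (g w - f w) (f w); rewrite subrK nKB => h1 h2; lra.
Qed.

Definition lincomb (s : seq (K * Om)) : (Om -> K) -> K :=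
  foldr (fun cw g => fun f => cw.1 * @delta R b Om cw.2 f + g f) (fun=> 0) s.

Lemma lincombE s f : lincomb s f = \sum_(cw <- s) cw.1 * f cw.2.
Proof. by elim: s => [|cw s IH] /=; rewrite ?big_nil// big_cons IH. Qed.

Lemma FVdual_lincomb s : FV' (lincomb s).
Proof. by elim: s => [|cw s IH]; [exact: FVdual_zero|exact: FVdual_axpy]. Qed.

(** The vector [(e, 0, ..., 0)] stays away from the image of [B] under [f'] and the evaluations at
    [ws], since small values at [ws] force [nK (f' f) < e / 2]. A separating combination [c] is at
    most 1 on [B] and has [nK (c ord0) * e >= 1]; dividing it by [c ord0] exhibits the approximation
    of [f'], with error at most [e]. *)
Lemma lincomb_dense (B : kidx) f' e : FV' f' -> 0 < e ->
  exists s, forall f, sval B f -> nK (f' f - lincomb s f) <= e.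
Proof.
move=> Ff' e0; have [Bne|B0] := pselect (sval B !=set0); last first.
  by exists nil => f Bf; case: B0; exists f.
have [Bac Bcp] := svalP B.
have e20 : 0 < e / 2 by rewrite divr_gt0.
have [ws [d [d0 H]]] := scompact_pointwise _ _ _ Bcp Ff' e20.
pose n := size ws.
pose F (i : 'I_n.+1) : (Om -> K) -> K :=
  if unlift ord0 i is Some j then fun f => f (tnth (in_tuple ws) j) else f'.
pose v (i : 'I_n.+1) : K := if unlift ord0 i is Some j then 0 else RK e.
have m0 : 0 < Num.min d (e / 2) by rewrite lt_min d0.
have [x y l m Bx By lm|x Bx h|c [cB cv]] := finite_separation _ _ _ (sval B) _ F v _ m0 Bne.
- exists (fun w => l * x w + m * y w); first exact: Bac.
  move=> i; rewrite /F; case: (unlift ord0 i) => [j //|].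
  have Fx : FV x by exact: Bcp.1.
  have Fy : FV y by exact: Bcp.1.
  by rewrite Ff'.1 ?(FVdual_scale Ff')//; exact: FVK_scale.
- have : nK (f' x) < e / 2.
    apply: (H x Bx) => w hw; have [j <-] := seqIn_tnth _ _ _ hw; have := h (lift ord0 j).
    by rewrite /v /F liftK sub0r nKN lt_min => /andP[].
  have := h ord0; rewrite /v /F unlift_none lt_min => /andP[_].
  have := nK_triangle (RK e - f' x) (f' x); rewrite subrK (nKRK_ge0 (ltW e0)); lra.
have cv0 : 1 <= nK (c ord0) * e.
  move: cv; rewrite big_ord_recl /v unlift_none big1 => [|j _]; last first.
    by rewrite liftK mulr0.
  by rewrite addr0 nKM (nKRK_ge0 (ltW e0)).
have c0 : 0 < nK (c ord0) by rewrite -(pmulr_lgt0 _ e0); lra.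
have c00 : c ord0 != 0 by apply/eqP => cz; move: c0; rewrite cz nK0 ltxx.
exists [seq (- (c ord0)^-1 * c (lift ord0 j), tnth (in_tuple ws) j) | j <- enum 'I_n].
move=> f Bf; rewrite lincombE big_map big_enum /=.
have := cB f Bf; rewrite big_ord_recl {1}/F unlift_none.
have -> : \sum_(i < n) c (lift ord0 i) * F (lift ord0 i) f =
    \sum_(i < n) c (lift ord0 i) * f (tnth (in_tuple ws) i).
  by apply: eq_bigr => i _; rewrite /F liftK.
set s := \sum_i _ => h.
have -> : \sum_(i < n) - (c ord0)^-1 * c (lift ord0 i) * f (tnth (in_tuple ws) i) =
    - (c ord0)^-1 * s.
  by rewrite mulr_sumr; apply: eq_bigr => j _; rewrite mulrA.
have -> : f' f - - (c ord0)^-1 * s = (c ord0)^-1 * (c ord0 * f' f + s).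
  by rewrite mulNr opprK mulrDr mulKf.
rewrite nKM nKV ler_pdivrMl//; lra.
Qed.

Section Evaluation.
Variables (m : M).

Lemma nu_TK_le j (x : om m) f : FV f -> nK (RK (nu j m x) * TK m f x) <= sem (j, m) f.
Proof. by move=> Ff; rewrite nKM (nKRK_ge0 (nu_ge0 _ _ _)) mulrC; exact: TK_le_sem. Qed.

Lemma FVdual_nu_TK j (x : om m) : FV' (fun f => RK (nu j m x) * TK m f x).
Proof.
apply/FVdualP; split=> [l f g Ff Fg|e e0].
  rewrite TK_linear; [by ring| |].
    by case: Ff => _ /(_ m)[].
  by case: Fg => _ /(_ m)[].
exists [:: (j, m)], e; split=> // f Ff /(_ _ (or_introl erefl)).
exact: le_lt_trans (nu_TK_le _ _ _ Ff).
Qed.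

Lemma FVdual_TK (x : om m) : FV' (fun f => TK m f x).
Proof.
have [j nuj] := nu_gt0 m x.
have := FVdual_axpy (RK (nu j m x))^-1 _ _ (FVdual_nu_TK j x) FVdual_zero.
have nz : RK (nu j m x) != 0 by rewrite RK_neq0// gt_eqF.
congr (FV' _); apply/funext => f; by rewrite addr0 mulKf.
Qed.

(** The bridge between the two topologies: on this set the [semEps] seminorm of [u] is the [semFVE]
    seminorm of [S u], by [TE_S_nu]. *)
Lemma equicont_nu_TK j : equicont nu APK domTK TK
  [set (fun f => RK (nu j m x) * TK m f x) | x in [set: om m]].
Proof.
apply/equicontP; split=> [_ [x _ <-]|e e0]; first exact: FVdual_nu_TK.
exists [:: (j, m)], e; split=> // _ f [x _ <-] Ff /(_ _ (or_introl erefl)).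
exact: le_lt_trans (nu_TK_le _ _ _ Ff).
Qed.

End Evaluation.

(** * The vector valued space and the epsilon product *)

Context {E : lmodType K} {A : Type} {p : A -> E -> R}
  {APE : set (Om -> E)} {domTE : forall m : M, set (Om -> E)}
  {TE : forall m : M, (Om -> E) -> (om m -> E)}.
Local Notation FE := (FVE nu p APE domTE TE).
Local Notation semE := (semFVE nu p TE).
Local Notation eps := (epsprod nu APK domTK TK p).
Local Notation seme := (@semEps R b Om J M om nu APK domTK TK E A p).

Hypothesis p_seminorm : forall a, is_seminorm (p a).
Hypothesis p_directed : sdirected p setT.
Hypothesis p_hausdorff : shausdorff p setT.

Let p_ge0 a x : 0 <= p a x. Proof. by case: (p_seminorm a). Qed.
Let pD a x y : p a (x + y) <= p a x + p a y.
Proof. by case: (p_seminorm a) => _ []. Qed.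
Let pZ a l x : p a (l *: x) = nK l * p a x. Proof. exact: seminormZ. Qed.
Let p0 a : p a 0 = 0. Proof. by case: (seminorms_on_E p_seminorm). Qed.

Lemma TE_le_sem f j m a x : FE f -> p a (TE m f x) * nu j m x <= semE (j, m, a) f.
Proof.
move=> [_ /(_ m)[_ /(_ j a)[C HC]]]; apply: ub_le_sup; last by exists x.
by exists C => _ [y _ <-].
Qed.

Lemma semE_le f j m a c : (forall x, p a (TE m f x) * nu j m x <= c) ->
  semE (j, m, a) f <= c.
Proof.
move=> h; apply: ge_sup; last by move=> _ [x _ <-].
by have [x] := om_inhabited m; exists (p a (TE m f x) * nu j m x), x.
Qed.

Lemma epsprodP u : eps u <->
  (forall (l : K) f' g', FV' f' -> FV' g' ->
     u (fun f => l * f' f + g' f) = l *: u f' + u g') /\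
  forall a, cont0 semk FV' (fun f' => p a (u f')).
Proof.
split=> -[lin ct]; split=> //.
  apply: (scont_cont0 seminorms_on_kappa (seminorms_on_E p_seminorm) u _ ct).
  have := lin (-1) _ _ FVdual_zero FVdual_zero.
  have -> : (fun f : Om -> K => -1 * 0 + 0) = (fun=> 0 : K).
    by apply/funext => f; rewrite mulr0 addr0.
  by rewrite scaleN1r addNr.
apply: (cont0_scont seminorms_on_kappa) => // f' g' Ff' Fg'.
by rewrite functional_subE lin// scaleN1r addrC.
Qed.

Section EpsElement.
Context {u : ((Om -> K) -> K) -> E}.
Hypothesis u_eps : eps u.

Lemma eps_zero : u (fun=> 0) = 0.
Proof.
have := u_eps.1 (-1) _ _ FVdual_zero FVdual_zero.
have -> : (fun f : Om -> K => -1 * 0 + 0) = (fun=> 0 : K).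
  by apply/funext => f; rewrite mulr0 addr0.
by rewrite scaleN1r addNr.
Qed.

Lemma eps_scale l f' : FV' f' -> u (fun f => l * f' f) = l *: u f'.
Proof.
move=> Ff'; have := u_eps.1 l _ _ Ff' FVdual_zero; rewrite eps_zero addr0 => <-.
by congr u; apply/funext => f; rewrite addr0.
Qed.

Lemma eps_sub f' g' : FV' f' -> FV' g' -> u (f' - g') = u f' - u g'.
Proof. by move=> Ff' Fg'; rewrite functional_subE u_eps.1// scaleN1r addrC. Qed.

(** Finitely many kappa-seminorms lie below a single one, so one compact set suffices. *)
Lemma eps_kappa a e : 0 < e -> exists B d, 0 < d /\
  forall f', FV' f' -> semk B f' < d -> p a (u f') < e.
Proof.
move=> e0; have [F [d [d0 H]]] := (proj1 (epsprodP u) u_eps).2 a e e0.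
have [B HB] := kappa_directed F; exists B, d; split=> // f' Ff' fd.
by apply: H => // B' /HB BB'; apply: le_lt_trans (semKappa_sub _ _ _ Ff' BB') fd.
Qed.

Lemma eps_bounded H a : equicont nu APK domTK TK H ->
  exists C, forall f', H f' -> p a (u f') <= C.
Proof.
move=> /equicontP[HF' He]; have [B [d [d0 H1]]] := eps_kappa a 1 ltr01.
have [C [C0 HC]] := equi0_bounded _ _ He HF' (svalP B).2.
pose t := 2 * C / d; have t0 : 0 < t by rewrite divr_gt0 ?mulr_gt0.
have tV : 0 <= t^-1 by rewrite invr_ge0 ltW.
exists t => f' Hf'; have Ff' := HF' _ Hf'.
have Ftf' : FV' (fun f => RK t^-1 * f' f).
  have := FVdual_axpy (RK t^-1) _ _ Ff' FVdual_zero.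
  by congr (FV' _); apply/funext => f; rewrite addr0.
have := H1 _ Ftf'; rewrite eps_scale// pZ (nKRK_ge0 tV) ltr_pdivrMl// mulr1.
move=> h; apply/ltW/h; apply: le_lt_trans (semKappa_scale _ _ _ Ff') _.
rewrite (nKRK_ge0 tV) ltr_pdivrMl//; apply: le_lt_trans (_ : C < _).
  by apply: semKappa_le => [|f Bf]; [exact: ltW|exact: HC].
by rewrite /t divfK ?gt_eqF//; lra.
Qed.

Lemma semEps_ge i f' : sval i.1 f' -> p i.2 (u f') <= seme i u.
Proof.
move=> Hf'; apply: ub_le_sup; last by exists f'.
have [C HC] := eps_bounded _ i.2 (svalP i.1).
by exists C => _ [g' Hg' <-]; exact: HC.
Qed.

End EpsElement.

Lemma semEps_le i u c : 0 <= c ->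
  (forall f', sval i.1 f' -> p i.2 (u f') <= c) -> seme i u <= c.
Proof. by move=> c0 h; apply: sup_le_nonneg => // _ [f' Hf' <-]; exact: h. Qed.

Lemma semEps_ge0 i u : eps u -> 0 <= seme i u.
Proof.
move=> eu; have [[f' Hf']|H0] := pselect (exists f', sval i.1 f').
  exact: le_trans (p_ge0 _ _) (semEps_ge eu _ _ Hf').
by rewrite /semEps sup_out// => -[[_ [f' Hf' _]] _]; apply: H0; exists f'.
Qed.

Lemma eps_axpy l u v : eps u -> eps v -> eps (fun f' => l *: u f' + v f').
Proof.
move=> /epsprodP[l1 c1] /epsprodP[l2 c2]; apply/epsprodP; split=> [k f' g' Ff' Fg'|a].
  by rewrite l1// l2// !scalerDr !scalerA mulrC addrACA.
apply: cont0_le (cont0_axpy _ _ _ (nK_ge0 l) (c1 a) (c2 a)) => f' _.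
by rewrite -pZ.
Qed.

Lemma eps_const0 : eps (fun=> 0).
Proof.
apply/epsprodP; split=> [l f' g' _ _|a]; first by rewrite scaler0 addr0.
by apply: cont0_le cont0_const0 => f' _; rewrite p0.
Qed.

Lemma eps_subE (u v : ((Om -> K) -> K) -> E) : u - v = (fun f' => -1 *: v f' + u f').
Proof. by apply/funext => f'; rewrite scaleN1r addrC. Qed.

Lemma seminorms_on_eps : seminorms_on seme eps.
Proof.
split; [exact: eps_const0| | |].
- by move=> u v eu ev; rewrite eps_subE; exact: eps_axpy.
- move=> i; apply/eqP; rewrite eq_le semEps_ge0 ?andbT; last exact: eps_const0.
  by apply: semEps_le => // f' _; rewrite p0.
move=> i u v eu ev; apply: semEps_le => [|f' Hf'].
  by rewrite addr_ge0 ?semEps_ge0.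
rewrite eps_subE; apply: le_trans (pD _ _ _) _.
by rewrite pZ nKN nK1 mul1r addrC lerD// semEps_ge.
Qed.

Lemma S_injective u v : eps u -> eps v -> S u = S v -> forall f', FV' f' -> u f' = v f'.
Proof.
move=> eu ev Suv f' Ff'; pose w := u - v.
have ew : eps w by rewrite /w eps_subE; exact: eps_axpy.
apply/eqP; rewrite -subr_eq0; apply/eqP; rewrite -[LHS]/(w f').
apply: contrapT => /(hausdorff_separated p_seminorm p_hausdorff)[a]; apply.
apply/eqP; rewrite eq_le p_ge0 andbT; apply/ler_addgt0Pr => e e0; rewrite add0r.
have [B [d [d0 H]]] := eps_kappa ew a e e0.
have d20 : 0 < d / 2 by rewrite divr_gt0.
have [s Hs] := lincomb_dense B f' (d / 2) Ff' d20.
have ws : w (lincomb s) = 0.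
  elim: s {Hs} => [|[c x] s IH] /=; first exact: eps_zero.
  rewrite ew.1; [|exact: delta_dual|exact: FVdual_lincomb].
  by rewrite IH addr0 /w /= !fctE -[u _]/(S u x) Suv subrr scaler0.
have Fs := FVdual_lincomb s.
rewrite -[w f']subr0 -ws -eps_sub//; apply/ltW/H; first exact: FVdual_subfunctional.
apply: le_lt_trans (_ : d / 2 < d); last by lra.
by apply: semKappa_le; [exact: ltW|exact: Hs].
Qed.

(** * Continuity of [S] and estimates over polars *)

Hypothesis Hstrong : strong nu APK domTK TK p APE domTE TE.
Hypothesis Hcons : consistent nu APK domTK TK p APE domTE TE.
Hypothesis Hkappa : FE `<=` FVkappa nu APK domTK TK p.

Lemma TE_S_nu u m j (x : om m) a : eps u ->
  p a (TE m (S u) x) * nu j m x = p a (u (fun f => RK (nu j m x) * TK m f x)).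
Proof.
move=> eu; have [_ [_ ->]] := Hcons _ eu m.
by rewrite (eps_scale eu) ?pZ ?(nKRK_ge0 (nu_ge0 _ _ _)) 1?mulrC//; exact: FVdual_TK.
Qed.

Lemma S_FVE u : inhabited M -> eps u -> FE (S u).
Proof.
move=> [m0] eu; split=> [|m]; first by case: (Hcons _ eu m0).
split=> [|j a]; first by case: (Hcons _ eu m) => _ [].
have [C HC] := eps_bounded eu _ a (equicont_nu_TK m j).
by exists C => x; rewrite TE_S_nu//; apply: HC; exists x.
Qed.

Lemma S_scont : inhabited M -> scont seme eps semE FE (@S R b Om E).
Proof.
move=> Mi; apply: (cont0_scont seminorms_on_eps) => //; first by move=> u; exact: S_FVE.
move=> [[j m] a] e e0.
pose H : {H | equicont nu APK domTK TK H} := exist _ _ (equicont_nu_TK m j).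
exists [:: (H, a)], e; split=> // u eu /(_ _ (or_introl erefl)).
apply: le_lt_trans; apply: semE_le => x; rewrite TE_S_nu//.
by apply: (semEps_ge eu (H, a)); exists x.
Qed.

(** Strength turns [TK m (Rf f e')] into [e'] applied to [TE m f], and a polar functional is
    dominated by [p a]. *)
Lemma sem_polarB f e' a j m : FE f -> polarB p a e' ->
  sem (j, m) (Rf f e') <= semE (j, m, a) f.
Proof.
move=> Ff e'a; apply: sem_le => x.
have [_ [_ ->]] := Hstrong _ e'a.1 _ Ff m.
apply: le_trans (TE_le_sem f j m a x Ff); rewrite ler_wpM2r//.
exact: polarB_le.
Qed.

Lemma Rf_FVK f e' : FE f -> Edual p e' -> FV (Rf f e').
Proof. by move=> /Hkappa[fs _]; exact: fs. Qed.

Lemma sclosure_absconvex (X : set (Om -> K)) : X `<=` FV -> absconvexK X ->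
  absconvexK (sclosure sem FV X).
Proof.
move=> XF Xac f g [Ff fX] [Fg gX] l m lm; split.
  by apply: FVK_axpy => //; exact: FVK_scale.
move=> F e e0; have e20 : 0 < e / 2 by rewrite divr_gt0.
have [f1 [Xf1 f1f]] := fX F _ e20; have [g1 [Xg1 g1g]] := gX F _ e20.
exists (fun w => l * f1 w + m * g1 w); split; first exact: Xac.
move=> i Fi.
have -> : (fun w => l * f1 w + m * g1 w) - (fun w => l * f w + m * g w) =
    (fun w => l * (f1 - f) w + m * (g1 - g) w).
  by apply/funext => w; rewrite !fctE; ring.
have [_ DB _ _] := seminorms_on_FVK.
have Fd := DB _ _ (XF _ Xf1) Ff; have Gd := DB _ _ (XF _ Xg1) Fg.
apply: le_lt_trans (sem_axpy _ _ _ _ Fd (FVK_scale _ _ Gd)) _.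
apply: le_lt_trans (_ : nK l * (e / 2) + nK m * (e / 2) < e).
  apply: lerD; first by rewrite ler_wpM2l ?nK_ge0// ltW// f1f.
  apply: le_trans (sem_scale _ _ _ Gd) _.
  by rewrite ler_wpM2l ?nK_ge0// ltW// g1g.
rewrite -mulrDl; apply: le_lt_trans (_ : 1 * (e / 2) < e); last by lra.
by rewrite ler_wpM2r// ltW.
Qed.

(** Compactness from [Hkappa] enters here: the closure of the image of the polar is absolutely
    convex and compact, hence an index of kappa. *)
Lemma kappa_polarB f a : FE f -> exists B : kidx,
  forall e', polarB p a e' -> sval B (Rf f e').
Proof.
move=> Ff; have [_ /(_ a) fc] := Hkappa _ Ff.
have XF : Rf f @` polarB p a `<=` FV by move=> _ [e' [e'd _] <-]; exact: Rf_FVK.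
have Xac : absconvexK (Rf f @` polarB p a).
  move=> _ _ [e1 e1a <-] [e2 e2a <-] l m lm.
  exists (fun x => l * e1 x + m * e2 x) => //; apply: polarB_bound => //.
    by move=> k x y; rewrite e1a.1.1 e2a.1.1; ring.
  move=> x px; apply: le_trans (nK_triangle _ _) _; rewrite !nKM.
  apply: le_trans lm; rewrite -[leRHS]mulr1 mulrDl.
  by rewrite lerD// ler_wpM2l ?nK_ge0//; [exact: e1a.2|exact: e2a.2].
exists (mk_kappa _ (sclosure_absconvex _ XF Xac) fc) => e' e'a /=.
by apply: (subset_sclosure seminorms_on_FVK _ XF); exists e'.
Qed.

(** This estimate is the kappa-continuity of the map sending a functional to its representing point;
    on differences within a net it yields Cauchy nets in [E]. *)
Lemma in_JE_bound f a : FE f -> exists B : kidx, forall g' x, FV' g' ->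
  (forall e', Edual p e' -> g' (Rf f e') = e' x) -> p a x <= semk B g'.
Proof.
move=> Ff; have [B HB] := kappa_polarB f a Ff; exists B => g' x Fg' gx.
apply: le_polarB => // e' e'a; rewrite -gx; last exact: e'a.1.
by apply: semKappa_ge => //; exact: HB.
Qed.

(** * Limits of functionals represented by points of [E] *)

Section NetLimit.
Context {f : Om -> E} {f' : (Om -> K) -> K} {T : Type} {le : T -> T -> Prop}
  {net : T -> ((Om -> K) -> K)} {x : T -> E}.
Hypothesis Ff : FE f.
Hypothesis Ff' : FV' f'.
Hypothesis le_dir : directed_order le.
Hypothesis Fnet : forall t, FV' (net t).
Hypothesis net_f' : net_cvg semk le net f'.
Hypothesis netx : forall t e', Edual p e' -> net t (Rf f e') = e' (x t).

Lemma net_JE_cauchy : net_cauchy p le x.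
Proof.
move=> F e e0; have e20 : 0 < e / 2 by rewrite divr_gt0.
have [B HB] := choice (fun a => in_JE_bound f a Ff).
have [t0 H] := net_f' (map B F) _ e20; exists t0 => s t t0s t0t a Fa.
apply: le_lt_trans (HB a (net s - net t) _ _ _) _.
- exact: FVdual_subfunctional.
- by move=> e' e'd; rewrite (EdualB e'd) -!netx.
have := seminorm_chain seminorms_on_kappa (B a) _ _ _ (Fnet t) Ff' (Fnet s).
rewrite (seminorm_distC seminorms_on_kappa (B a) f' (net t))//.
have BF := seqIn_map _ _ B _ _ Fa.
by have := H s t0s _ BF; have := H t t0t _ BF; lra.
Qed.

Lemma net_JE_limit l : net_cvg p le x l -> forall e', Edual p e' -> f' (Rf f e') = e' l.
Proof.
move=> xl e' e'd; have [x0|] := pselect (inhabited A); last first.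
  (* With an empty family of seminorms the Hausdorff property forces [E = 0], and both sides
     vanish. *)
  move=> A0; have E0 (y : E) : y = 0.
    apply: contrapT => /(hausdorff_separated p_seminorm p_hausdorff)[a _].
    by apply: A0; exists.
  have -> : Rf f e' = (fun=> 0).
    by apply/funext => w; rewrite /Rf (E0 (f w)) (Edual0 e'd).
  by rewrite (FVdual_const0 Ff') (E0 l) (Edual0 e'd).
(* A positive multiple of [e'] lies in a polar, where [kappa_polarB] gives uniform control; the
   factor is cancelled afterwards. *)
have [a [C [C0 e''a]]] := Edual_polarB p_seminorm p_directed _ x0 e'd.
set e'' := (fun x => _) in e''a.
have RC : RK C != 0 by rewrite RK_neq0 ?gt_eqF.
apply: (mulfI RC).
have <- : f' (Rf f e'') = RK C * f' (Rf f e').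
  by rewrite -(FVdual_scale Ff')//; exact: Rf_FVK.
rewrite -[RHS]/(e'' l); apply/eqP; rewrite -subr_eq0; apply/eqP/nK_eq0/eqP.
rewrite eq_le nK_ge0 andbT; apply/ler_addgt0Pr => e e0; rewrite add0r.
have e20 : 0 < e / 2 by rewrite divr_gt0.
have [B HB] := kappa_polarB f a Ff.
have [t0 H0] := net_f' [:: B] _ e20; have [t1 H1] := xl [:: a] _ e20.
have [_ [_ [_ ub]]] := le_dir; have [t [t0t t1t]] := ub t0 t1.
have h0 := H0 t t0t B (or_introl erefl); have h1 := H1 t t1t a (or_introl erefl).
have -> : f' (Rf f e'') - e'' l = (e'' (x t) - e'' l) - (net t - f') (Rf f e'').
  by rewrite !fctE netx; [ring|exact: e''a.1].
apply: le_trans (nK_triangle _ _) _; rewrite nKN -(EdualB e''a.1).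
have := polarB_le p_seminorm a e'' (x t - l) e''a.
have := semKappa_ge B (net t - f') (Rf f e'') (FVdual_subfunctional _ _ (Fnet t) Ff') (HB _ e''a).
by lra.
Qed.

End NetLimit.

(** The representing point is the same linear combination of values of [f]. *)
Lemma lincomb_in_JE f s : exists x, forall e', Edual p e' -> lincomb s (Rf f e') = e' x.
Proof.
elim: s => [|[c w] s [x IH]]; first by exists 0 => e' e'd; rewrite (Edual0 e'd).
exists (c *: f w + x) => e' e'd; rewrite e'd.1 -IH//.
Qed.

Lemma in_JE_complete f f' : scomplete p setT -> FE f -> FV' f' -> in_JE p f f'.
Proof.
move=> cpl Ff Ff'; pose T := (seq kidx * nat)%type.
(* An index is a finite family of compact sets with an accuracy: the approximation at [t] has error
   at most [1 / (t.2 + 1)] on every set in [t.1]. *)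
pose le (s t : T) := (forall B, seqIn B s.1 -> seqIn B t.1) /\ (s.2 <= t.2)%N.
have le_dir : directed_order le.
  split; first by exists (nil, 0%N).
  split; first by [].
  split=> [s t u [h1 h2] [h3 h4]|s t].
    by split=> [B /h1/h3//|]; exact: leq_trans h2 h4.
  exists (s.1 ++ t.1, maxn s.2 t.2); split; split=> /=.
  - by move=> B hB; apply/seqIn_cat; left.
  - exact: leq_maxl.
  - by move=> B hB; apply/seqIn_cat; right.
  - exact: leq_maxr.
have approx (t : T) : exists s, forall B f, seqIn B t.1 -> sval B f ->
    nK (f' f - lincomb s f) <= t.2.+1%:R^-1.
  have [B HB] := kappa_directed t.1.
  have [//|s Hs] := lincomb_dense B f' t.2.+1%:R^-1 Ff'.
    by rewrite invr_gt0.
  by exists s => B' g /HB BB' /BB'; exact: Hs.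
have [s Hs] := choice approx.
pose net t := lincomb (s t).
have Fnet t : FV' (net t) by exact: FVdual_lincomb.
have net_f' : net_cvg semk le net f'.
  move=> F e e0; pose n := Num.bound e^-1.
  have ne : n.+1%:R^-1 < e.
    rewrite -[e]invrK ltf_pV2 ?posrE ?invr_gt0//.
    apply: lt_le_trans (archi_boundP _) _; first by rewrite invr_ge0 ltW.
    by rewrite ler_nat.
  exists (F, n) => t [Ft nt] B FB; apply: le_lt_trans ne.
  apply: le_trans (_ : t.2.+1%:R^-1 <= _).
    apply: semKappa_le => [|g Bg]; first by rewrite invr_ge0.
    by rewrite fctE nKB; apply: Hs Bg; exact: Ft.
  by rewrite lef_pV2 ?posrE// ler_nat.
have [x netx] := choice (fun t => lincomb_in_JE f (s t)).
have [//|l [_ xl]] := cpl T le le_dir x _ (net_JE_cauchy Ff Ff' Fnet net_f' netx).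
by exists l; exact: (net_JE_limit Ff Ff' le_dir Fnet net_f' netx l xl).
Qed.

Lemma in_JE_seq_complete f f' (s : nat -> ((Om -> K) -> K)) : sseq_complete p setT ->
  FE f -> FV' f' -> (forall n, FV' (s n)) ->
  net_cvg semk (fun m n => (m <= n)%N) s f' -> (forall n, in_JE p f (s n)) -> in_JE p f f'.
Proof.
move=> cpl Ff Ff' Fs sf' /choice[x sx].
have le_dir : directed_order (fun m n : nat => (m <= n)%N).
  split; first by exists 0%N.
  split; first by move=> n; exact: leqnn.
  split=> [m n k|m n]; first exact: leq_trans.
  by exists (maxn m n); rewrite leq_maxl leq_maxr.
have [//|l [_ xl]] := cpl x _ (net_JE_cauchy Ff Ff' Fs sf' sx).
by exists l; exact: (net_JE_limit Ff Ff' le_dir Fs sf' sx l xl).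
Qed.

Lemma in_JE_quasi_complete f f' (T : Type) (le : T -> T -> Prop)
    (net : T -> ((Om -> K) -> K)) :
  squasi_complete p setT (fun (l : K) (x : E) => l *: x) ->
  FE f -> FV' f' -> directed_order le -> (forall t, FV' (net t)) ->
  sbounded semk FV' (@scaleDual R b Om) (range net) ->
  net_cvg semk le net f' -> (forall t, in_JE p f (net t)) -> in_JE p f f'.
Proof.
move=> qc Ff Ff' le_dir Fnet net_bnd net_f' /choice[x netx].
have pT := seminorms_on_E p_seminorm.
(* Boundedness passes from the net to [x] through one kappa-seminorm: every [net t] is [l] times an
   element of its unit ball. *)
have xb a : exists c, forall t, p a (x t) <= c.
  have [B HB] := in_JE_bound f a Ff.
  have F0 : FV' 0 by exact: FVdual_zero.
  have [|l Hl] := net_bnd _ (sopen_sball seminorms_on_kappa [:: B] 0 1 F0).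
    by split=> //; exact: (sball_center seminorms_on_kappa).
  exists (nK l) => t; have [|y [[Fy yB] nety]] := Hl (net t); first by exists t.
  apply: le_trans (HB _ _ (Fnet t) (netx t)) _; rewrite nety.
  apply: le_trans (semKappa_scale _ _ _ Fy) _; rewrite -[leRHS]mulr1.
  rewrite ler_wpM2l ?nK_ge0//; have := yB B (or_introl erefl).
  by rewrite subr0 => /ltW.
have [c Hc] := choice xb.
(* Quasi-completeness concerns closed bounded sets; passing to the closure costs at most 1 in each
   seminorm. *)
pose X := sclosure p setT (range x).
have Xb a y : X y -> p a y <= c a + 1.
  move=> [_ /(_ [:: a] 1 ltr01)[_ [[t _ <-] /(_ a (or_introl erefl)) ty]]].
  have := seminorm_chain pT a 0 (x t) y Logic.I Logic.I Logic.I; rewrite !subr0.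
  by rewrite (seminorm_distC pT)//; have := Hc a t; lra.
have Xbnd : sbounded p setT (fun (l : K) (x : E) => l *: x) X.
  move=> U [_ Uo] U0; have [F [e [e0 FU]]] := Uo 0 U0.
  have [C C0 HC] := seqIn_upper_bound _ _ F (fun a => c a + 1).
  pose t := 2 * C / e; have t0 : 0 < t by rewrite divr_gt0 ?mulr_gt0.
  have tV : 0 <= t^-1 by rewrite invr_ge0 ltW.
  exists (RK t) => y Xy; exists (RK t^-1 *: y); split; last first.
    by rewrite scalerA -RKM divff ?gt_eqF// RK1 scale1r.
  apply: FU; split=> // a Fa; rewrite subr0 pZ (nKRK_ge0 tV) ltr_pdivrMl//.
  apply: le_lt_trans (Xb a y Xy) _; apply: le_lt_trans (HC a Fa) _.
  by rewrite /t divfK ?gt_eqF//; lra.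
have xX t : X (x t) by apply: (subset_sclosure pT) => //; exists t.
have [l [_ xl]] := qc X Xbnd (sclosure_closed pT _ (@subsetT _ _)) T le le_dir x xX
  (net_JE_cauchy Ff Ff' Fnet net_f' netx).
by exists l; exact: (net_JE_limit Ff Ff' le_dir Fnet net_f' netx l xl).
Qed.

(** * Representation from weakly compact sets *)

Lemma FVdual_bounded f' : inhabited J -> inhabited M -> sdirected sem FV -> FV' f' ->
  exists j m C, 0 < C /\ forall f c, FV f -> sem (j, m) f <= c -> nK (f' f) <= C * c.
Proof.
move=> [j0] [m0] semdir Ff'; have [_ ct] := proj1 (FVdualP _) Ff'.
have [F [d [d0 H]]] := ct 1 ltr01.
have [[j m] [C [C0 HC]]] := sdirected_seq seminorms_on_FVK F (inhabits (j0, m0)) semdir.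
exists j, m, (C / d); split=> [|f c Ff fc]; first by rewrite divr_gt0.
apply: le_trans (_ : C / d * sem (j, m) f <= _); last first.
  by rewrite ler_wpM2l// ltW// divr_gt0.
apply/ler_addgt0Pr => e e0.
have sf := seminorm_ge0 seminorms_on_FVK (j, m) f Ff.
pose t := C / d * sem (j, m) f + e.
have t0 : 0 < t by rewrite /t ltr_wpDl// mulr_ge0// ltW// divr_gt0.
have tV : 0 <= t^-1 by rewrite invr_ge0 ltW.
have := H _ (FVK_scale (RK t^-1) f Ff); rewrite (FVdual_scale Ff')// nKM (nKRK_ge0 tV).
rewrite ltr_pdivrMl// mulr1 => h; apply/ltW/h => i Fi.
apply: le_lt_trans (sem_scale _ _ _ Ff) _; rewrite (nKRK_ge0 tV) ltr_pdivrMl//.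
apply: le_lt_trans (HC i f Fi Ff) _; rewrite -ltr_pdivrMr// /t.
by rewrite mulrAC ltrDl.
Qed.

Lemma seminorms_on_weak : seminorms_on (@qweak R b E A p) setT.
Proof.
split=> // [[e' e'd]|[e' e'd] x y _ _]; rewrite /qweak /=.
  by rewrite (Edual0 e'd) nK0.
by rewrite (EdualB e'd); apply: le_trans (nK_triangle _ _) _; rewrite nKN.
Qed.

Lemma Edual_sum f f' (I : Type) (r : seq I) (c : I -> K) (e : I -> E -> K) :
  FE f -> FV' f' -> (forall i, Edual p (e i)) ->
  Edual p (fun x => \sum_(i <- r) c i * e i x) /\
  f' (Rf f (fun x => \sum_(i <- r) c i * e i x)) = \sum_(i <- r) c i * f' (Rf f (e i)).
Proof.
move=> Ff Ff' ed; elim: r => [|i r [IH1 IH2]].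
  have -> : (fun x => \sum_(i <- [::]) c i * e i x) = (fun=> 0).
    by apply/funext => x; rewrite big_nil.
  by split; [exact: Edual_const0|rewrite big_nil; exact: (FVdual_const0 Ff')].
have -> : (fun x => \sum_(i <- i :: r) c i * e i x) =
    (fun x => c i * e i x + \sum_(i <- r) c i * e i x).
  by apply/funext => x; rewrite big_cons.
split; first exact: Edual_axpy.
by rewrite big_cons -IH2 -Ff'.1//; exact: Rf_FVK.
Qed.

(* With the constant doubled, a combination of functionals separating the
   targets from the weakly compact set contradicts the bound on [f']. *)
Lemma in_JE_weakly_compact f f' : inhabited J -> inhabited M -> sdirected sem FV ->
  FE f -> FV' f' ->
  (forall (j : J) (m : M), exists C : set E, absconvexE C /\
     scompact (@qweak R b E A p) setT C /\ Nset nu TE f j m `<=` C) ->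
  in_JE p f f'.
Proof.
move=> Ji Mi semdir Ff Ff' Hd.
(* Directedness bounds [f'] by a single seminorm, and its pair [(j, m)] selects the weakly compact
   set. *)
have [j [m [C [C0 HC]]]] := FVdual_bounded f' Ji Mi semdir Ff'.
have [B [Bac [Bcp NB]]] := Hd j m.
have C20 : 0 < 2 * C by lra.
have Bne : B !=set0.
  have [x] := om_inhabited m; exists (RK (nu j m x) *: TE m f x).
  by apply: NB; exists x.
(* By strength the values of [e'] on [Nset] are the weighted values of [TK m (Rf f e')], so a bound
   for [e'] on [B] bounds the seminorm [(j, m)]. *)
have bnd e' s : Edual p e' -> (forall k, B k -> nK (e' k) <= s) ->
    nK (f' (Rf f e')) <= C * s.
  move=> e'd h; apply: HC; first exact: Rf_FVK.
  apply: sem_le => x; have [_ [_ ->]] := Hstrong _ e'd _ Ff m.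
  have := h (RK (nu j m x) *: TE m f x); rewrite (EdualZ e'd) nKM.
  rewrite (nKRK_ge0 (nu_ge0 _ _ _)) mulrC; apply.
  by apply: NB; exists x.
apply: contrapT => notJ.
(* [P X] provides finitely many functionals and one gap [d] that exclude every [RK (2 * C) *: k]
   with [k] in [X] as an approximate representing point. If no point represents [f'], this holds
   locally, hence on [B]. *)
pose P (X : set E) := exists (L : seq {e' | Edual p e'}) d, 0 < d /\ forall k, X k ->
  ~ (forall e', seqIn e' L ->
       nK (f' (Rf f (sval e')) - RK (2 * C) * sval e' k) < d).
have [L [d [d0 HL]]] : P B.
  apply: (scompact_induction seminorms_on_weak B P Bcp).
  - by exists nil, 1.
  - by move=> X Y XY [L [d [d0 h]]]; exists L, d; split=> // k /XY; exact: h.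
  - move=> X Y [L [d [d0 h]]] [L' [d' [d'0 h']]].
    exists (L ++ L'), (Num.min d d'); split; first by rewrite lt_min d0.
    move=> k [Xk|Yk] hk.
      apply: (h k Xk) => e' Le'; have := hk e' (proj2 (seqIn_cat _ _ _ _) (or_introl Le')).
      by rewrite lt_min => /andP[].
    apply: (h' k Yk) => e' Le'; have := hk e' (proj2 (seqIn_cat _ _ _ _) (or_intror Le')).
    by rewrite lt_min => /andP[].
  - move=> k Bk; have [e' [e'd e'k]] : exists e', Edual p e' /\
        f' (Rf f e') - RK (2 * C) * e' k <> 0.
      apply: contrapT => /forallNP h; apply: notJ; exists (RK (2 * C) *: k) => e' e'd.
      rewrite /JE (EdualZ e'd); apply/eqP; rewrite -subr_eq0; apply/eqP.
      by apply: contrapT => h'; apply: (h e').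
    have n0 := nK_gt0 _ e'k; set n := nK _ in n0.
    (* Within this radius [RK (2 * C) * e' k] changes by less than [n / 2]. *)
    exists [:: exist _ e' e'd], (n / 2 / (2 * C)); split; first by rewrite !divr_gt0.
    exists [:: exist _ e' e'd], (n / 2); split; first by rewrite divr_gt0.
    move=> k' [_ /(_ _ (or_introl erefl)) kk'] /(_ _ (or_introl erefl)) /= hk'.
    move: kk'; rewrite /qweak /= (EdualB e'd) ltr_pdivlMr// => kk'.
    have : n <= nK (f' (Rf f e') - RK (2 * C) * e' k') + nK (RK (2 * C) * (e' k' - e' k)).
      by apply: le_trans (nK_triangle _ _); rewrite /n le_eqVlt; apply/orP; left; apply/eqP;
         congr (nK _); ring.
    by rewrite nKM (nKRK_ge0 (ltW C20)) [2 * C * nK _]mulrC; lra.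
pose n := size L; pose e i := sval (tnth (in_tuple L) i).
have ed i : Edual p (e i) by exact: svalP.
have [x y l k Bx By lk|k Bk h|c [cB cv]] := finite_separation R b E B n
    (fun i k => RK (2 * C) * e i k) (fun i => f' (Rf f (e i))) d d0 Bne.
- exists (l *: x + k *: y); first exact: Bac.
  by move=> i; rewrite (ed i).1 (EdualZ (ed i)); ring.
- by apply: (HL k Bk) => e' Le'; have [i <-] := seqIn_tnth _ _ _ Le'; exact: h.
have [sd sE] := Edual_sum f f' _ (index_enum 'I_n) c e Ff Ff' ed.
(* The combination is at most [(2 * C)^-1] on [B], so [f'] has modulus at most [1 / 2] on it,
   against the lower bound 1 from separation. *)
have := bnd _ (2 * C)^-1 sd; rewrite sE => h.
suff : nK (\sum_i c i * f' (Rf f (e i))) <= C * (2 * C)^-1.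
  by rewrite invfM mulrCA divff ?gt_eqF// mulr1; lra.
apply: h => k Bk; rewrite -[leRHS]mul1r ler_pdivlMr//.
have := cB k Bk; have -> : \sum_i c i * (RK (2 * C) * e i k) = RK (2 * C) * \sum_i c i * e i k.
  by rewrite mulr_sumr; apply: eq_bigr => i _; rewrite mulrCA.
by rewrite nKM (nKRK_ge0 (ltW C20)) mulrC.
Qed.

(** * The inverse of [S] and its continuity *)

Hypothesis all_in_JE : forall f f', FE f -> FV' f' -> in_JE p f f'.

(** [u f'] is the point representing [f']: linearity holds because [E'] separates points, and
    continuity is [in_JE_bound]. *)
Lemma S_surjective f : FE f -> exists u, eps u /\ S u = f /\
  forall f', FV' f' -> forall e', Edual p e' -> Rft f f' e' = JE (u f') e'.
Proof.
move=> Ff; have ex f' : exists x, FV' f' -> forall e', Edual p e' -> Rft f f' e' = JE x e'.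
  have [Ff'|nF] := pselect (FV' f'); last by exists 0.
  by have [x hx] := all_in_JE _ _ Ff Ff'; exists x.
have [u hu] := choice ex; exists u; split; last first.
  split=> //; apply/funext => w; apply: (Edual_eq p_seminorm p_hausdorff) => e' e'd.
  by rewrite -[LHS]/(JE (u (delta w)) e') -hu.
apply/epsprodP; split=> [l f' g' Ff' Fg'|a e e0].
  apply: (Edual_eq p_seminorm p_hausdorff) => e' e'd; rewrite e'd.1.
  have h1 := hu _ Ff' _ e'd; have h2 := hu _ Fg' _ e'd.
  have h3 := hu _ (FVdual_axpy l _ _ Ff' Fg') _ e'd.
  by rewrite /JE in h1 h2 h3; rewrite -h1 -h2 -h3.
have [B HB] := in_JE_bound f a Ff; exists [:: B], e; split=> // f' Ff'.
move=> /(_ B (or_introl erefl)); apply: le_lt_trans; apply: HB => // e' e'd.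
exact: hu.
Qed.

(** The preimage of [S u] built in [S_surjective] satisfies the identity by construction, and
    injectivity identifies it with [u] on FV(Om)'. *)
Lemma eps_representation u f' e' : inhabited M -> eps u -> FV' f' -> Edual p e' ->
  f' (Rf (S u) e') = e' (u f').
Proof.
move=> Mi eu Ff' e'd; have [v [ev [Svu hv]]] := S_surjective _ (S_FVE _ Mi eu).
by rewrite (S_injective _ _ eu ev (esym Svu) _ Ff'); exact: hv.
Qed.

Lemma S_open U : inhabited M -> sopen seme eps U -> sopen semE FE (@S R b Om E @` U).
Proof.
move=> Mi [Ueps Uo]; split=> [_ [u Uu <-]|_ [u0 Uu0 <-]]; first exact/S_FVE/Ueps.
have eu0 := Ueps _ Uu0; have [F [e [e0 FU]]] := Uo _ Uu0.
(* It suffices to bound [semEps] of [u] by finitely many [semFVE] seminorms of [S u]. On the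
   equicontinuous [H], seminorms of [Rf (S u) e'] control [f' (Rf (S u) e')], and [sem_polarB]
   bounds them uniformly over the polar. *)
have small i : cont0 (fun k u => semE k (S u)) eps (seme i).
  case: i => [[H Heq] a] e1 e10; have e20 : 0 < e1 / 2 by rewrite divr_gt0.
  have [HF' He] := proj1 (equicontP _) Heq.
  have [L [d [d0 HL]]] := He _ e20.
  exists (map (fun i => (i, a)) L), d; split=> // u eu hu.
  apply: le_lt_trans (_ : e1 / 2 < e1); last by lra.
  apply: semEps_le => [|f' /= Hf']; first exact: ltW.
  have FSu := S_FVE _ Mi eu.
  apply: le_polarB => // e' e'a; rewrite -eps_representation//; last exact: e'a.1.
    apply/ltW/HL => //; first by apply: Rf_FVK => //; exact: e'a.1.
    move=> [j m] Li; apply: le_lt_trans (sem_polarB _ _ _ _ _ FSu e'a) _.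
    by apply: hu; exact: (seqIn_map _ _ (fun i => (i, a))).
  exact: HF'.
have [F' [d [d0 H]]] := cont0_seqIn _ seme F e small e0.
exists F', d; split=> // f [Ff fd]; have [u [eu [Su _]]] := S_surjective _ Ff.
exists u => //; apply: FU; split=> // i Fi; apply: H Fi.
  by case: seminorms_on_eps => _ DB _ _; exact: DB.
by move=> k Fk; have := fd k Fk; rewrite -Su.
Qed.

End ScalarFV.

(* K = Kf R b is R (b = true) or C = R[i] (b = false). *)
Theorem theorem3p17
  (R : realType) (b : bool)
  (* the index data *)
  (Om : Type) (J M : Type) (om : M -> Type)
  (nu : J -> forall m : M, om m -> R)
  (HOm : inhabited Om) (HJ : inhabited J) (HM : inhabited M)
  (Hom : forall m, inhabited (om m))
  (Hnu0 : forall j m x, 0 <= nu j m x)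
  (Hnu : forall m (x : om m), exists j, 0 < nu j m x)
  (* the scalar valued setting *)
  (APK : set (Om -> Kf R b)) (domTK : forall m : M, set (Om -> Kf R b))
  (TK : forall m : M, (Om -> Kf R b) -> (om m -> Kf R b))
  (HAPK : lsubK APK) (HdomTK : forall m, lsubK (domTK m))
  (HTK : forall m (l : Kf R b) f g, domTK m f -> domTK m g ->
      TK m (fun w => l * f w + g w) = (fun x => l * TK m f x + TK m g x))
  (* the locally convex space E *)
  (E : lmodType (Kf R b)) (A : Type) (p : A -> E -> R)
  (Hsemi : forall a, is_seminorm (p a))
  (Hdir : sdirected p setT)
  (Hhaus : shausdorff p setT)
  (Hnontriv : exists x : E, x <> 0)
  (* the vector valued setting *)
  (APE : set (Om -> E)) (domTE : forall m : M, set (Om -> E))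
  (TE : forall m : M, (Om -> E) -> (om m -> E))
  (HAPE : lsubE APE) (HdomTE : forall m, lsubE (domTE m))
  (HTE : forall m (l : Kf R b) f g, domTE m f -> domTE m g ->
      TE m (fun w => l *: f w + g w) = (fun x => l *: TE m f x + TE m g x))
  (* (T^E_m, T^K_m) is a generator: both spaces are dom-spaces *)
  (HdomK : dom_space_K nu APK domTK TK)
  (HdomE : dom_space_E nu p APE domTE TE)
  (* strong and consistent *)
  (Hstrong : strong nu APK domTK TK p APE domTE TE)
  (Hcons : consistent nu APK domTK TK p APE domTE TE)
  (* FV(Om,E) is contained in FV(Om,E)_kappa *)
  (Hkappa : FVE nu p APE domTE TE `<=` FVkappa nu APK domTK TK p)
  (* one of the conditions (a)-(d) *)
  (Hcond :
     (* (a) *)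
     scomplete p setT
     \/
     (* (b) *)
     (squasi_complete p setT (fun (l : Kf R b) (x : E) => l *: x) /\
      forall f, FVE nu p APE domTE TE f ->
      forall f', FVdual nu APK domTK TK f' ->
      exists (T : Type) (le : T -> T -> Prop) (net : T -> ((Om -> Kf R b) -> Kf R b)),
        directed_order le /\
        (forall t, FVdual nu APK domTK TK (net t)) /\
        sbounded (@semKappa R b Om J M om nu APK domTK TK)
                 (FVdual nu APK domTK TK) (@scaleDual R b Om) (range net) /\
        net_cvg (@semKappa R b Om J M om nu APK domTK TK) le net f' /\
        (forall t, in_JE p f (net t)))
     \/
     (* (c) *)
     (sseq_complete p setT /\
      forall f, FVE nu p APE domTE TE f ->
      forall f', FVdual nu APK domTK TK f' ->
      exists s : nat -> ((Om -> Kf R b) -> Kf R b),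
        (forall n, FVdual nu APK domTK TK (s n)) /\
        net_cvg (@semKappa R b Om J M om nu APK domTK TK)
                (fun m n => (m <= n)%N) s f' /\
        (forall n, in_JE p f (s n)))
     \/
     (* (d) *)
     (forall f, FVE nu p APE domTE TE f -> forall (j : J) (m : M),
        exists C : set E, absconvexE C /\ scompact (@qweak R b E A p) setT C /\
          Nset nu TE f j m `<=` C)) :
  (* S maps FV(Om) eps E into FV(Om,E) *)
  (forall u, epsprod nu APK domTK TK p u -> FVE nu p APE domTE TE (S u)) /\
  (* S is linear *)
  (forall (l : Kf R b) (u v : ((Om -> Kf R b) -> Kf R b) -> E),
     S (fun f' => l *: u f' + v f') = (fun x => l *: S u x + S v x)) /\
  (* S is injective (elements of the eps-product are maps on FV(Om)') *)
  (forall u v, epsprod nu APK domTK TK p u -> epsprod nu APK domTK TK p v ->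
     S u = S v -> forall f', FVdual nu APK domTK TK f' -> u f' = v f') /\
  (* S is onto, with inverse f |-> J^{-1} o R_f^t *)
  (forall f, FVE nu p APE domTE TE f ->
     exists u, epsprod nu APK domTK TK p u /\ S u = f /\
       forall f', FVdual nu APK domTK TK f' ->
         forall e', Edual p e' -> Rft f f' e' = JE (u f') e') /\
  (* S is continuous *)
  scont (@semEps R b Om J M om nu APK domTK TK E A p) (epsprod nu APK domTK TK p)
        (semFVE nu p TE) (FVE nu p APE domTE TE) (@S R b Om E) /\
  (* S is open (equivalently, its inverse is continuous) *)
  (forall U, sopen (@semEps R b Om J M om nu APK domTK TK E A p)
                   (epsprod nu APK domTK TK p) U ->
     sopen (semFVE nu p TE) (FVE nu p APE domTE TE) ((@S R b Om E) @` U)).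
Proof.
have [_ [semdir delta_dual]] := HdomK.
(* The four alternatives enter only through this representation property. *)
have all_in_JE f f' : FVE nu p APE domTE TE f -> FVdual nu APK domTK TK f' -> in_JE p f f'.
  move=> Ff Ff'; case: Hcond => [cpl|[[qc Hb]|[[sc Hc]|Hd]]].
  - by apply: in_JE_complete Ff Ff'.
  - have [T [le [net [le_dir [Fnet [bnd [cvg inJ]]]]]]] := Hb f Ff f' Ff'.
    by apply: in_JE_quasi_complete qc Ff Ff' le_dir Fnet bnd cvg inJ.
  - have [s [Fs [cvg inJ]]] := Hc f Ff f' Ff'.
    by apply: in_JE_seq_complete sc Ff Ff' Fs cvg inJ.
  - by apply: in_JE_weakly_compact HJ HM semdir Ff Ff' (Hd f Ff).
split; first by move=> u eu; apply: S_FVE HM eu.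
split; first by [].
split; first by move=> u v eu ev Suv f' Ff'; apply: S_injective eu ev Suv f' Ff'.
split; first by move=> f Ff; apply: S_surjective Ff.
split; first by apply: S_scont HM.
by move=> U Uo; apply: S_open HM Uo.
Qed.
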